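(* Let $F$ be a nonempty closed subset of $H$, let $(\lambda_n)_{n\in\mathbb N}$ be a sequence in $(0,1]$, and let $(t_n)_{n\in\mathbb N}$, $(x_n)_{n\in\mathbb N}$, and $(e_n)_{n\in\mathbb N}$ be sequences of $H$-valued random variables. Suppose that the following hold: (i) $(\forall n\in\mathbb N)$ $x_{n+1}=x_n+\lambda_n(t_n+e_n-x_n)$. (ii) $\sum_{n\in\mathbb N}\lambda_n\sqrt{\mathsf E(\|e_n\|^2\mid\mathcal X_n)}<+\infty$ $\mathsf P$-a.s. (iii) For every $z\in F$, there exist $(\theta_n(z))_{n\in\mathbb N}\in\ell_+(\mathscr X)$, $(\mu_n(z))_{n\in\mathbb N}\in\ell_+^\infty(\mathscr X)$, and $(\nu_n(z))_{n\in\mathbb N}\in\ell_+^\infty(\mathscr X)$ such that $(\lambda_n\mu_n(z))_{n\in\mathbb N}\in\ell_+^1(\mathscr X)$, $(\lambda_n\nu_n(z))_{n\in\mathbb N}\in\ell_+^{1/2}(\mathscr X)$, and the following is satisfied $\mathsf P$-a.s.: $$(\forall n\in\mathbb N)\quad \mathsf E(\|t_n-z\|^2\mid\mathcal X_n)+\theta_n(z)\le(1+\mu_n(z))\|x_n-z\|^2+\nu_n(z).$$ Then, for every $z\in F$, $\sum_{n\in\mathbb N}\lambda_n\theta_n(z)<+\infty$ $\mathsf P$-a.s., and $$\sum_{n\in\mathbb N}\lambda_n(1-\lambda_n)\,\mathsf E(\|t_n-x_n\|^2\mid\mathcal X_n)<+\infty\quad\mathsf P\text{-a.s.}$$ Furthermore,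 suppose that: (iv) $\mathfrak W(x_n)_{n\in\mathbb N}\subset F$ $\mathsf P$-a.s. Then $(x_n)_{n\in\mathbb N}$ converges weakly $\mathsf P$-a.s. to an $F$-valued random variable $x$. If, in addition, (v) $\mathfrak S(x_n)_{n\in\mathbb N}\neq\varnothing$ $\mathsf P$-a.s., then $(x_n)_{n\in\mathbb N}$ converges strongly $\mathsf P$-a.s. to $x$.
   Context: $H$ is a separable real Hilbert space with norm $\|\cdot\|$ and Borel $\sigma$-algebra $\mathcal B$; $(\Omega,\mathcal F,\mathsf P)$ is the underlying probability space. An $H$-valued random variable is a measurable map $(\Omega,\mathcal F)\to(H,\mathcal B)$. For a sequence $(y_n)_{n\in\mathbb N}$ in $H$, $\mathfrak S(y_n)_{n\in\mathbb N}$ and $\mathfrak W(y_n)_{n\in\mathbb N}$ denote its sets of strong and weak sequential cluster points, respectively; for random sequences these are taken pointwise in $\omega$. Given the sequence $(x_n)_{n\in\mathbb N}$ of $H$-valued random variables, $\mathscr X=(\mathcal X_n)_{n\in\mathbb N}$ with $\mathcal X_n=\sigma(x_0,\dots,x_n)$. $\ell_+(\mathscr X)$ is the set of sequences $(\xi_n)_{n\in\mathbb N}$ of $[0,+\infty)$-valued random variables such that $\xi_n$ is $\mathcal X_n$-measurable for every $n$. For $p\in(0,+\infty)$, $\ell_+^p(\mathscr X)=\{(\xi_n)_{n\in\mathbb N}\in\ell_+(\mathscr X):\sum_{n\in\mathbb N}\xi_n^p<+\infty\ \mathsf P\text{-a.s.}\}$, and $\ell_+^\infty(\mathscr X)=\{(\xi_n)_{n\in\mathbb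 N}\in\ell_+(\mathscr X):\sup_{n\in\mathbb N}\xi_n<+\infty\ \mathsf P\text{-a.s.}\}$. Equalities and inequalities involving random variables are understood to hold $\mathsf P$-almost surely. *)

(* Defs.v *)
From HB Require Import structures.
From mathcomp Require Import all_boot all_order all_algebra.
From mathcomp Require Import all_classical all_reals all_analysis.
From mathcomp Require Import measurable_realfun.

Set Implicit Arguments.
Unset Strict Implicit.
Unset Printing Implicit Defensive.
Import Order.TTheory GRing.Theory Num.Theory.
Import numFieldNormedType.Exports.

Local Open Scope classical_set_scope.
Local Open Scope ring_scope.

Definition separable (T : topologicalType) : Prop :=
  exists2 S : set T, countable S & dense S.

Section sequences_in_hilbert.
Context {R : realType} {H : completeNormedModType R}.
Variable dot : {dot H for idfun}.

Definition norm_from_dot : Prop := forall u : H, `|u| ^+ 2 = dot u u.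

Definition weak_cvg (y : nat -> H) (l : H) : Prop :=
  forall u : H, dot (y n) u @[n --> \oo] --> (dot l u : R).

Definition subsequence_index (k : nat -> nat) : Prop :=
  {homo k : m n / (m < n)%N}.

Definition strong_cluster (y : nat -> H) : set H :=
  [set l | exists2 k, subsequence_index k & y (k n) @[n --> \oo] --> l].

Definition weak_cluster (y : nat -> H) : set H :=
  [set l | exists2 k, subsequence_index k & weak_cvg (fun n => y (k n)) l].

End sequences_in_hilbert.

Definition borelType (T : ptopologicalType) := g_sigma_algebraType (@open T).

Definition random_element d (Omega : measurableType d) (T : ptopologicalType)
    (X : Omega -> T) : Prop :=
  measurable_fun [set: Omega] (X : Omega -> borelType T).

Definition measurable_wrt (Omega : Type) (G : set (set Omega))
    d' (T : measurableType d') (f : Omega -> T) : Prop :=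
  forall B, measurable B -> G (f @^-1` B).

Definition natural_filtration (Omega : Type) (T : ptopologicalType)
    (x : nat -> Omega -> T) (n : nat) : set (set Omega) :=
  <<s \bigcup_(i in `I_n.+1)
        preimage_set_system setT (x i) (@measurable _ (borelType T)) >>.

Section conditional_expectation.
Local Open Scope ereal_scope.
Context d {Omega : measurableType d} {R : realType}.
Variable P : probability Omega R.

(* No integrability is required: for nonnegative X the conditional
   expectation always exists as a [0, +oo]-valued random variable.  G is meant to be a
   sigma-algebra. *)
Definition is_cond_exp (G : set (set Omega)) (X Y : Omega -> \bar R) : Prop :=
  [/\ forall w, 0 <= Y w, measurable_wrt G Y &
      forall A, G A -> \int[P]_(w in A) Y w = \int[P]_(w in A) X w].

(* An arbitrary version; versions exist (cond_expP) and agree P-almost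
   surely, so almost sure statements do not depend on the choice. *)
Definition cond_exp (G : set (set Omega)) (X : Omega -> \bar R) :
    Omega -> \bar R :=
  xget (cst 0) [set Y | is_cond_exp G X Y].

End conditional_expectation.

Section adapted_sequences.
Context d {Omega : measurableType d} {R : realType}.
Variable P : probability Omega R.
Variable X : nat -> set (set Omega).

Definition ell_plus : set (nat -> Omega -> R) :=
  [set xi : nat -> Omega -> R | forall n, (forall w, 0 <= xi n w) /\ measurable_wrt (X n) (xi n)].

Definition ell_plus_p (p : R) : set (nat -> Omega -> R) :=
  [set xi : nat -> Omega -> R | ell_plus xi /\
     {ae P, forall w, (\sum_(0 <= n <oo) (xi n w `^ p)%:E < +oo)%E}].

Definition ell_plus_oo : set (nat -> Omega -> R) :=
  [set xi : nat -> Omega -> R | ell_plus xi /\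
     {ae P, forall w, (ereal_sup (range (fun n => (xi n w)%:E)) < +oo)%E}].

End adapted_sequences.

Section natural_filtration_theory.
Context d {Omega : measurableType d} (T : ptopologicalType).
Variable x : nat -> Omega -> T.

Lemma sigma_algebra_natural_filtration n :
  sigma_algebra setT (natural_filtration x n).
Proof. exact: smallest_sigma_algebra. Qed.

Lemma natural_filtration_measurable n :
  (forall i, random_element (x i)) ->
  natural_filtration x n `<=` @measurable _ Omega.
Proof.
move=> mx; apply: smallest_sub; first exact: sigma_algebra_measurable.
by move=> A [i _ [B mB <-]]; exact: mx.
Qed.

End natural_filtration_theory.

Section cond_exp_existence.
Local Open Scope ereal_scope.
Context d {Omega : measurableType d} {R : realType}.
Variables (P : probability Omega R) (G : set (set Omega)).
Hypotheses (sG : sigma_algebra setT G) (GM : G `<=` @measurable _ Omega).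

Let OG := g_sigma_algebraType G.

Let mOG (A : set OG) : measurable A -> measurable (A : set Omega).
Proof. by rewrite /measurable/= (sigma_algebra_id sG) => /GM. Qed.

Let mid : measurable_fun [set: Omega] (id : Omega -> OG).
Proof. by move=> _ A mA; rewrite setTI; exact: mOG. Qed.

Let toOG : {mfun Omega >-> OG} :=
  HB.pack (id : Omega -> OG) (isMeasurableFun.Build _ _ _ _ _ mid).

Section bounded_piece.
Variables (X : Omega -> \bar R) (D : set Omega).
Hypotheses (mX : measurable_fun setT X) (X0 : forall w, 0 <= X w).
Hypotheses (mD : measurable D) (XD : \int[P]_(w in D) X w < +oo).

Definition piece (A : set OG) := \int[P]_(w in (A : set Omega) `&` D) X w.

Let piece0 : piece set0 = 0.
Proof. by rewrite /piece set0I integral_set0. Qed.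

Let piece_ge0 A : 0 <= piece A.
Proof. by apply: integral_ge0. Qed.

Let piece_sigma_additive : semi_sigma_additive piece.
Proof.
move=> F mF tF mUF; rewrite /piece setI_bigcupl.
rewrite ge0_integral_bigcup//.
- by apply: is_cvg_nneseries => n _ _; exact: piece_ge0.
- by move=> k; apply: measurableI => //; exact: mOG.
- exact: measurable_funTS.
- exact: trivIset_setIr.
Qed.

HB.instance Definition _ :=
  isMeasure.Build _ OG R piece piece0 piece_ge0 piece_sigma_additive.

Let piece_fin : fin_num_fun piece.
Proof.
move=> A mA; rewrite ge0_fin_numE; last exact: piece_ge0.
apply: le_lt_trans XD; apply: ge0_subset_integral => //.
- by apply: measurableI => //; exact: mOG.
- exact: measurable_funTS.
Qed.

HB.instance Definition _ := @Measure_isFinite.Build _ OG R piece piece_fin.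

Lemma cond_exp_piece : exists f : Omega -> \bar R,
  is_cond_exp P G (X \_ D) f.
Proof.
have [|f [f0 _ /integrableP[mf _] fE]] := @radon_nikodym_sigma_finite _ OG R
    (distribution P toOG) piece.
  apply/null_content_dominatesP => A mA PA.
  rewrite /= /piece; apply: null_set_integral.
  - by apply: measurableI => //; exact: mOG.
  - exact: measurable_funTS.
  - apply/eqP; rewrite eq_le measure_ge0 andbT -[X in _ <= X]PA.
    by apply: le_measure; rewrite ?inE//; [apply: measurableI|]; try exact: mOG.
exists f; split => //.
- move=> B mB; have := mf measurableT B mB.
  by rewrite setTI /measurable/= (sigma_algebra_id sG).
- move=> A GA.
  have mA : measurable (A : set OG) by exact: sub_sigma_algebra.
  rewrite -integral_mkcondr -[RHS]/(piece A) fE// ge0_integral_pushforward//.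
  exact: measurable_funTS.
Qed.

End bounded_piece.

Lemma cond_expP (X : Omega -> R) :
  measurable_fun setT X -> (forall w, (0 <= X w)%R) ->
  is_cond_exp P G (EFin \o X) (cond_exp P G (EFin \o X)).
Proof.
move=> mX X0.
have mEX : measurable_fun setT (EFin \o X) by exact/measurable_EFinP.
have EX0 w : 0 <= (EFin \o X) w by rewrite lee_fin.
pose B k : set Omega := X @^-1` `[k%:R, k.+1%:R[.
have mB k : measurable (B k) by rewrite -[B k]setTI; exact: mX.
have BT : \bigcup_k B k = setT.
  apply/seteqP; split => // w _; exists (Num.truncn (X w)) => //.
  by rewrite /B/= in_itv/= truncn_itv.
have tB : trivIset setT B.
  apply/trivIsetP => i j _ _ /eqP ij; apply/seteqP; split => // w [].
  rewrite /B/= !in_itv/= => /andP[i1 i2] /andP[j1 j2]; apply: ij.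
  have := le_lt_trans i1 j2; have := le_lt_trans j1 i2.
  by rewrite !ltr_nat !ltnS => ji ij; apply/eqP; rewrite eqn_leq ij ji.
have BX k : \int[P]_(w in B k) (EFin \o X) w < +oo.
  apply: (@le_lt_trans _ _ (\int[P]_(w in B k) (k.+1%:R)%:E)).
    apply: ge0_le_integral => //.
    - exact: measurable_funTS.
    - by move=> w; rewrite /B/= in_itv/= lee_fin => /andP[_ /ltW].
  rewrite integral_cst// lte_mul_pinfty//.
  exact: le_lt_trans (probability_le1 P (mB k)) (ltry _).
have [f fE] := choice (fun k => cond_exp_piece mEX EX0 (mB k) (BX k)).
have f0 k w : 0 <= f k w by have [] := fE k.
have Gf k : measurable_fun [set: OG] (f k : OG -> \bar R).
  have [_ mf _] := fE k; move=> _ C mC.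
  by rewrite setTI; apply: sub_sigma_algebra; exact: mf.
apply: (@xgetPex _ (cst 0) [set Y | is_cond_exp P G (EFin \o X) Y]).
exists (fun w => \sum_(0 <= k <oo) f k w); split.
- by move=> w; exact: nneseries_ge0.
- have mY : measurable_fun [set: OG] (fun w : OG => \sum_(0 <= k <oo) f k w).
    exact: ge0_emeasurable_sum.
  move=> C mC; have := mY measurableT C mC.
  by rewrite setTI {1}/measurable/= (sigma_algebra_id sG).
- move=> A GA; have mA : measurable A by exact: GM.
  rewrite integral_nneseries//; last first.
    move=> k; apply: measurable_funTS => _ C mC.
    exact: (mOG (Gf k measurableT C mC)).
  rewrite -[in RHS](setIT A) -BT setI_bigcupr ge0_integral_bigcup//.
  + apply: eq_eseriesr => k _; have [_ _ ->//] := fE k.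
    by rewrite -integral_mkcondr.
  + by move=> k; exact: measurableI.
  + exact: measurable_funTS.
  + exact: trivIset_setIl.
Qed.

End cond_exp_existence.

(* Main.v *)
Require Import Defs.
From HB Require Import structures.
From mathcomp Require Import all_boot all_order all_algebra.
From mathcomp Require Import all_classical all_reals all_analysis.
From mathcomp Require Import measurable_realfun.
From mathcomp Require Import ring lra.

Set Implicit Arguments.
Unset Strict Implicit.
Unset Printing Implicit Defensive.
Import Order.TTheory GRing.Theory Num.Theory.
Import numFieldNormedType.Exports.

Local Open Scope classical_set_scope.
Local Open Scope ring_scope.

(** Fix a target point z in F and write a_n for the squared distance from x_n
to z.  Since x_(n+1) - z is the sum of the relaxed step
(1 - lambda_n) (x_n - z) + lambda_n (t_n - z) and of the error lambda_n e_n,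
the parallelogram-type identity for relaxed steps [sqr_norm_relaxation] and the
inequality |u + v|^2 <= (1 + eps) |u|^2 + (1 + 1/eps) |v|^2 give, with eps_n
equal to lambda_n sqrt E(|e_n|^2 | X_n) plus a summable positive sequence, an
almost-supermartingale inequality
  E(a_(n+1) | X_n) + theta'_n <= (1 + mu'_n) a_n + nu'_n
with mu'_n and nu'_n almost surely summable and
  theta'_n = lambda_n theta_n + lambda_n (1 - lambda_n) E(|t_n - x_n|^2 | X_n)
([one_step_decrease]).  Taking eps_n slightly larger than the error avoids a
division by zero, and Young's inequality replaces a conditional
Cauchy-Schwarz inequality.  The Robbins-Siegmund theorem [robbins_siegmund] then
yields both announced series and the almost sure convergence of a_n
([quasi_fejer]).

Conditional inequalities are used throughout in integrated form, tested against
nonnegative weights measurable for the conditioning sigma-algebra; this makes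
sense without integrability, and [integral_weight_eq] passes between a
nonnegative variable and its conditional expectation.  The Robbins-Siegmund
theorem reduces, after division by the products of the 1 + mu'_k and
localization on the events where a_0 and the partial sums of nu' stay bounded, to
the convergence of nonnegative supermartingales, which rests on Doob's
upcrossing argument ([upcrossing_gain], [nonneg_supermartingale_cvg]).

For the weak limit, a countable dense subset of F provides a single almost
sure event on which the distance from x_n to every point of F converges.  There
Opial's argument applies ([opial]): the sequence is bounded, hence has a weak
cluster point ([weak_compact], by an ultrafilter limit and Riesz
representation), and two weak cluster points in F must coincide.  The weak limit is
measurable because its inner products are limits of random variables and the
space is separable ([random_element_dot]).  A strong cluster point must be
the weak limit x, and then the convergent distance from x_n to x has limit 0
([cvg_weak_dist_strong_cluster]). *)

(** * Weighted integrals over a sub-sigma-algebra *)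

Section sub_sigma_algebra.
Context d {Omega : measurableType d} (G : set (set Omega)).
Hypotheses (sG : sigma_algebra setT G) (GM : G `<=` @measurable _ Omega).

Lemma measurable_sub_sigma (A : set (g_sigma_algebraType G)) :
  measurable A <-> G A.
Proof. by rewrite {1}/measurable/= (sigma_algebra_id sG). Qed.

Lemma measurable_fun_sub_sigma d' (T : measurableType d')
    (f : g_sigma_algebraType G -> T) :
  measurable_fun setT f -> measurable_fun [set: Omega] (f : Omega -> T).
Proof.
move=> mf _ B mB; rewrite setTI; apply: GM; apply/measurable_sub_sigma.
by rewrite -[_ @^-1` _]setTI; exact: mf.
Qed.

Lemma measurable_wrtP d' (T : measurableType d') (f : Omega -> T) :
  measurable_wrt G f <-> measurable_fun setT (f : g_sigma_algebraType G -> T).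
Proof.
split=> [mf _ B mB|mf B mB].
  by rewrite setTI; apply/measurable_sub_sigma; exact: mf.
by apply/measurable_sub_sigma; rewrite -[_ @^-1` _]setTI; exact: mf.
Qed.

End sub_sigma_algebra.

Section weighted_integral.
Local Open Scope ereal_scope.
Context d {Omega : measurableType d} {R : realType}.
Variables (P : {measure set Omega -> \bar R}) (G : set (set Omega)).
Hypotheses (sG : sigma_algebra setT G) (GM : G `<=` @measurable _ Omega).

Import HBNNSimple.

Let OG := g_sigma_algebraType G.

Let integral_nnsfunM (g : {nnsfun OG >-> R}) (X : Omega -> \bar R) :
  measurable_fun setT X -> (forall w, 0 <= X w) ->
  \int[P]_w ((g w)%:E * X w) =
  \sum_(k \in range g) (k%:E * \int[P]_(w in g @^-1` [set k]) X w).
Proof.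
move=> mX X0.
have mg k : measurable (g @^-1` [set k] : set Omega).
  by apply: GM; apply/(measurable_sub_sigma sG).
have m1 k : measurable_fun setT (\1_(g @^-1` [set k]) : Omega -> R).
  exact: measurable_indic.
under eq_integral => w _.
  rewrite fimfunE -fsumEFin// ge0_mule_fsuml; last first.
    by move=> k; rewrite EFinM; exact: nnfun_muleindic_ge0.
  over.
rewrite ge0_integral_fsum//; last 2 first.
- move=> k; apply: emeasurable_funM => //.
  by apply/measurable_EFinP; exact: measurable_funM.
- by move=> k w _; rewrite mule_ge0// EFinM; exact: nnfun_muleindic_ge0.
apply: eq_fsbigr => k; rewrite inE /= => -[w _ gwk].
have k0 : (0 <= k)%R by rewrite -gwk.
under eq_integral do rewrite EFinM -muleA.
rewrite ge0_integralZl//; last 2 first.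
- by apply: emeasurable_funM => //; exact/measurable_EFinP.
- by move=> t _; rewrite mule_ge0// lee_fin.
rewrite [in RHS]integral_mkcond; congr (_ * _); apply: eq_integral => t _.
rewrite patchE indicE; case: ifPn => tk; first by rewrite mul1e.
by rewrite mul0e.
Qed.

(** The defining property of a conditional expectation extends from indicators
to nonnegative weights: by linearity to simple weights, then by monotone
convergence.  The values may be infinite. *)
Lemma integral_weight_eq (X Y : Omega -> \bar R) (phi : OG -> \bar R) :
  measurable_fun setT X -> (forall w, 0 <= X w) ->
  measurable_fun setT Y -> (forall w, 0 <= Y w) ->
  (forall A, G A -> \int[P]_(w in A) Y w = \int[P]_(w in A) X w) ->
  measurable_fun setT phi -> (forall w, 0 <= phi w) ->
  \int[P]_w (phi w * Y w) = \int[P]_w (phi w * X w).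
Proof.
move=> mX X0 mY Y0 YX mphi phi0.
pose g := nnsfun_approx measurableT mphi.
have cvgI Z : measurable_fun setT Z -> (forall w, 0 <= Z w) ->
    \int[P]_w ((g n w)%:E * Z w) @[n --> \oo] --> \int[P]_w (phi w * Z w).
  move=> mZ Z0; have gZ w : phi w * Z w = limn (fun n => (g n w)%:E * Z w).
    apply/esym/cvg_lim => //.
    have gphi : (g n w)%:E @[n --> \oo] --> phi w by exact: cvg_nnsfun_approx.
    (* The product of limits is safe only when neither factor can be 0 against
       +oo, hence the separate treatment of vanishing factors. *)
    have := Z0 w; rewrite le_eqVlt => /predU1P[<-|Zw].
      by rewrite mule0; under eq_fun do rewrite mule0; exact: cvg_cst.
    have := phi0 w; rewrite le_eqVlt => /predU1P[phiw|phiw].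
      have g0 n : g n w = 0%R.
        apply/eqP; rewrite eq_le; apply/andP; split => //.
        rewrite -lee_fin [leRHS]phiw [X in (X w)%:E]nnsfun_approxE.
        exact: le_approx.
      rewrite -phiw mul0e; under eq_fun do rewrite g0 mul0e.
      exact: cvg_cst.
    apply: cvgeM => //; last exact: cvg_cst.
    by rewrite neq0_mule_def// gt_eqF// mule_gt0.
  under [X in _ --> X]eq_integral do rewrite gZ.
  apply: cvg_monotone_convergence => //.
  - move=> n; apply: emeasurable_funM => //; apply/measurable_EFinP.
    exact: (measurable_fun_sub_sigma sG GM).
  - by move=> n w _; rewrite mule_ge0// lee_fin.
  - move=> w _ m n mn; rewrite lee_wpmul2r// lee_fin.
    by have /lefP := nd_nnsfun_approx measurableT mphi mn; apply.
have e n : \int[P]_w ((g n w)%:E * Y w) = \int[P]_w ((g n w)%:E * X w).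
  rewrite !integral_nnsfunM//; apply: eq_fsbigr => k _; congr (_ * _).
  by apply: YX; exact/(measurable_sub_sigma sG).
have cY := cvgI _ mY Y0; rewrite (eq_cvg _ _ e) in cY.
exact: (cvg_unique _ cY (cvgI _ mX X0)).
Qed.

End weighted_integral.

(** * Nonnegative series and almost sure statements *)

Section nonneg_series.
Context {R : realType}.
Implicit Types u : nat -> R.

Lemma nneseries_ltyP u : (forall n, 0 <= u n) ->
  (\sum_(0 <= n <oo) (u n)%:E < +oo)%E <->
  exists C, forall n, \sum_(0 <= k < n) u k <= C.
Proof.
move=> u0; have u0E n : (0 <= (u n)%:E)%E by rewrite lee_fin.
split=> [uy|[C uC]].
  exists (fine (\sum_(0 <= n <oo) (u n)%:E)%E) => n.
  rewrite -lee_fin fineK; last by rewrite ge0_fin_numE// nneseries_ge0.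
  by rewrite -sumEFin; apply: nneseries_lim_ge.
apply: (@le_lt_trans _ _ C%:E); last exact: ltry.
apply: lime_le; first exact: is_cvg_nneseries.
by apply: nearW => n; rewrite sumEFin lee_fin.
Qed.

Lemma nneseries_lty_is_cvg u : (forall n, 0 <= u n) ->
  (\sum_(0 <= n <oo) (u n)%:E < +oo)%E -> cvgn (series u).
Proof.
move=> u0 /(nneseries_ltyP u0)[C uC]; apply: nondecreasing_is_cvgn.
  exact: nondecreasing_series.
by exists C => _ [n _ <-]; exact: uC.
Qed.

End nonneg_series.

Section nonneg_series_operations.
Context {R : realType}.
Implicit Types u v c : nat -> R.

Lemma nneseries_lty_bounded u : (forall n, 0 <= u n) ->
  (\sum_(0 <= n <oo) (u n)%:E < +oo)%E ->
  exists2 C, 0 <= C & forall n, u n <= C.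
Proof.
move=> u0 /(nneseries_ltyP u0)[C uC].
have uC' n : u n <= C.
  by apply: le_trans (uC n.+1); rewrite big_nat_recr//= lerDr sumr_ge0.
by exists C => //; apply: le_trans (uC' 0%N).
Qed.

Lemma nneseries_ltyM c u (C : R) : (forall n, 0 <= u n) ->
  (forall n, 0 <= c n <= C) -> (\sum_(0 <= n <oo) (u n)%:E < +oo)%E ->
  (\sum_(0 <= n <oo) (c n * u n)%:E < +oo)%E.
Proof.
move=> u0 cC /(nneseries_ltyP u0)[M uM].
have cu0 n : 0 <= c n * u n by rewrite mulr_ge0//; case/andP: (cC n).
apply/(nneseries_ltyP cu0); exists (C * M) => n.
have C0 : 0 <= C by case/andP: (cC 0%N); exact: le_trans.
apply: le_trans (ler_wpM2l C0 (uM n)).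
rewrite mulr_sumr; apply: ler_sum => k _.
by rewrite ler_wpM2r//; case/andP: (cC k).
Qed.

Lemma nneseries_ltyD u v : (forall n, 0 <= u n) -> (forall n, 0 <= v n) ->
  (\sum_(0 <= n <oo) (u n)%:E < +oo)%E -> (\sum_(0 <= n <oo) (v n)%:E < +oo)%E ->
  (\sum_(0 <= n <oo) (u n + v n)%:E < +oo)%E.
Proof.
move=> u0 v0 su sv; under eq_eseriesr do rewrite EFinD.
by rewrite nneseriesD ?lte_add_pinfty// => n _ _; rewrite lee_fin.
Qed.

Lemma nneseries_lty_geometric : (\sum_(0 <= n <oo) ((2 ^- n.+1 : R))%:E < +oo)%E.
Proof.
have g0 n : 0 <= 2 ^- n.+1 :> R by rewrite invr_ge0 exprn_ge0.
apply/(nneseries_ltyP g0); exists 1 => n.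
have -> : \sum_(0 <= k < n) 2 ^- k.+1 = 1 - 2 ^- n :> R.
  elim: n => [|n ih]; first by rewrite big_geq// expr0 invr1 subrr.
  rewrite big_nat_recr//= ih exprS invfM; lra.
by rewrite lerBlDr lerDl invr_ge0 exprn_ge0.
Qed.

(** The square roots are bounded, so each term is at most a constant times its
square root. *)
Lemma nneseries_lty_sqrt u : (forall n, 0 <= u n) ->
  (\sum_(0 <= n <oo) (u n `^ 2^-1)%:E < +oo)%E ->
  (\sum_(0 <= n <oo) (u n)%:E < +oo)%E.
Proof.
move=> u0 su; have r0 n : 0 <= u n `^ 2^-1 by exact: powR_ge0.
have [C C0 rC] := nneseries_lty_bounded r0 su.
rewrite (_ : (fun n => _) = fun n =>
    \sum_(0 <= k < n) ((u k `^ 2^-1) * (u k `^ 2^-1))%:E)%E.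
  by apply: (@nneseries_ltyM _ _ C) => // n; rewrite r0 rC.
apply/funext => n; apply: eq_bigr => k _; congr EFin.
by rewrite powR12_sqrt// -expr2 sqr_sqrtr.
Qed.

End nonneg_series_operations.

Section almost_everywhere.
Context d {Omega : measurableType d} {R : realType}.
Variable P : {measure set Omega -> \bar R}.

Lemma ae_forall_countable (I : countType) (Q : I -> Omega -> Prop) :
  (forall i, {ae P, forall w, Q i w}) -> {ae P, forall w, forall i, Q i w}.
Proof.
move=> aeQ.
have : {ae P, forall w, forall n, if unpickle n is Some i then Q i w else True}.
  by apply: ae_foralln => n; case: unpickle => //; exact: aeW.
by apply: filterS => w Qw i; have := Qw (pickle i); rewrite pickleK.
Qed.

Lemma ae_lty_integral (f : Omega -> \bar R) :
  measurable_fun setT f -> (forall w, (0 <= f w)%E) ->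
  (\int[P]_w f w < +oo)%E -> {ae P, forall w, (f w < +oo)%E}.
Proof.
move=> mf f0 fy.
have : P.-integrable setT f.
  apply/integrableP; split => //.
  by under eq_integral do rewrite gee0_abs//.
move/(integrable_ae measurableT); apply: filterS => w /(_ I).
by rewrite ge0_fin_numE.
Qed.

End almost_everywhere.

(** * Upcrossings and nonnegative supermartingales *)

Section upcrossing.
Context {R : realType}.
Variables (a b : R) (u : nat -> R).

(** The classical trading strategy: buy when [u] is below [a], keep until it exceeds
[b].  Its completed transactions are the upcrossings of [a, b]. *)
Fixpoint holding n : bool :=
  if n is m.+1 then (if holding m then u m.+1 <= b else u m.+1 < a)
  else u 0%N < a.

Definition upcrossing n : bool := holding n && ~~ holding n.+1.

(** Pathwise form of Doob's upcrossing inequality.  Each completed transaction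
gains at least b - a and the open position loses at most a because u is
nonnegative.  The increments of the gain process are kept split into their two
nonnegative halves so that the inequality can be integrated term by term. *)
Lemma upcrossing_gain n : 0 <= a -> (forall k, 0 <= u k) ->
  (b - a) * \sum_(0 <= k < n) (upcrossing k)%:R +
    \sum_(0 <= k < n) (holding k)%:R * u k
  <= a + \sum_(0 <= k < n) (holding k)%:R * u k.+1.
Proof.
move=> a0 u0.
(* Invariant for the induction: an open position is counted at its current
   value relative to the entry threshold. *)
suff H : (b - a) * \sum_(0 <= k < n) (upcrossing k)%:R +
    \sum_(0 <= k < n) (holding k)%:R * u k + (holding n)%:R * (u n - a)
  <= \sum_(0 <= k < n) (holding k)%:R * u k.+1.
  move: H; have := u0 n; case: (holding n) => /=; lra.
elim: n => [|n]; first by rewrite !big_geq//=; have [] := ltP (u 0%N) a => /=; lra.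
rewrite !big_nat_recr//= /upcrossing/=.
case: (holding n) => /=.
  by have [] := leP (u n.+1) b => /=; lra.
by have [] := ltP (u n.+1) a => /=; lra.
Qed.

(** Finitely many completed transactions: the strategy ends up either holding
forever or waiting forever. *)
Lemma finite_upcrossing_dichotomy :
  (\sum_(0 <= k <oo) ((upcrossing k)%:R : R)%:E < +oo)%E ->
  (\forall n \near \oo, u n <= b) \/ (\forall n \near \oo, a <= u n).
Proof.
move=> /nneseries_lty_is_cvg -/(_ (fun=> ler0n _ _))/cvg_series_cvg_0.
move=> /cvgrPdist_lt/(_ 1 ltr01)[N _ NU].
have {}NU n : (N <= n)%N -> ~~ upcrossing n.
  by move/NU => /=; rewrite sub0r normrN; case: upcrossing; rewrite //= normr1 ltxx.
have [[m Nm hm]|nh] := pselect (exists2 m, (N <= m)%N & holding m).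
  have hk k : holding (m + k).
    elim: k => [|k ih]; rewrite ?addn0// addnS.
    have := NU (m + k)%N (leq_trans Nm (leq_addr _ _)).
    by rewrite /upcrossing ih/= negbK.
  left; exists m.+1 => // n /= mn.
  case: n mn => // n mn.
  have := hk (n.+1 - m)%N; have := hk (n - m)%N.
  by rewrite subnKC// subnKC 1?leqW//= => ->.
right; exists N.+1 => // -[//|n] /= Nn.
rewrite leNgt; apply/negP => una; apply: nh; exists n.+1; first exact: leqW.
rewrite /= una; case: ifPn => // hn.
by have := NU n Nn; rewrite /upcrossing /= hn negbK.
Qed.

End upcrossing.

(** The candidate limit is the supremum of the eventual lower bounds of [u]; rational
pairs just above it force the eventual upper bounds. *)
Lemma is_cvg_no_oscillation (R : realType) (u : nat -> R) (M : R) :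
  (forall n, 0 <= u n) -> ~ (\forall n \near \oo, M <= u n) ->
  (forall q r : rat, 0 <= ratr q :> R -> q < r ->
    (\forall n \near \oo, u n <= ratr r) \/ (\forall n \near \oo, ratr q <= u n)) ->
  cvgn u.
Proof.
move=> u0 uM osc.
pose S := [set s : R | \forall n \near \oo, s <= u n].
have S0 : S 0 by exact: nearW.
have SM : ubound S M.
  move=> s Ss; rewrite leNgt; apply/negP => Ms; apply: uM.
  by apply: filterS Ss => n; apply: le_trans; exact: ltW.
have hS : has_sup S by split; [exists 0|exists M].
apply/cvg_ex; exists (sup S); apply/cvgrPdist_le => e e0.
have l0 : 0 <= sup S by exact: sup_upper_bound.
have [q /itvP qP] := @rat_in_itvoo R (sup S) (sup S + e) ltac:(lra).
have [r /itvP rP] := @rat_in_itvoo R (ratr q) (sup S + e) ltac:(by rewrite qP).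
have [s Ss se] := sup_adherent e0 hS.
have ub : \forall n \near \oo, u n <= ratr r.
  have [||//|qS] := osc q r.
  - by rewrite (le_trans l0)// ltW// qP.
  - by rewrite -(ltr_rat R) rP.
  have := sup_upper_bound hS qS.
  by rewrite leNgt qP.
near=> n; rewrite ler_distlC; apply/andP; split.
  by apply: le_trans (ltW se) _; near: n.
have rl : ratr r <= sup S + e by rewrite ltW// rP.
by apply: le_trans rl; near: n.
Unshelve. all: by end_near. Qed.

Section filtration.
Context d {Omega : measurableType d}.

Definition filtration (G : nat -> set (set Omega)) : Prop :=
  [/\ forall n, sigma_algebra setT (G n),
      forall n, G n `<=` @measurable _ Omega &
      forall n, G n `<=` G n.+1].

Lemma measurable_fun_filtration (G : nat -> set (set Omega)) (m n : nat)
    d' (T : measurableType d') (f : Omega -> T) :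
  filtration G -> (m <= n)%N ->
  measurable_fun setT (f : g_sigma_algebraType (G m) -> T) ->
  measurable_fun setT (f : g_sigma_algebraType (G n) -> T).
Proof.
move=> [sG _ Gm] mn mf; have Gmn : G m `<=` G n.
  elim: n mn => [|n ih]; first by rewrite leqn0 => /eqP ->.
  by rewrite leq_eqVlt => /predU1P[->//|/ih] Gmn; exact: subset_trans (Gm n).
apply/(measurable_wrtP (sG n)) => B mB; apply: Gmn.
by move/(measurable_wrtP (sG m)) : mf; apply.
Qed.

End filtration.

Section supermartingale.
Context d {Omega : measurableType d} {R : realType}.
Variables (P : probability Omega R) (G : nat -> set (set Omega)).
Variable N : nat -> Omega -> R.
Hypothesis fG : filtration G.
Hypothesis mN : forall n, measurable_fun setT (N n : g_sigma_algebraType (G n) -> R).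
Hypothesis N0 : forall n w, 0 <= N n w.
Hypothesis intN0 : (\int[P]_w (N 0%N w)%:E < +oo)%E.
Hypothesis superN : forall n A, G n A ->
  (\int[P]_(w in A) (N n.+1 w)%:E <= \int[P]_(w in A) (N n w)%:E)%E.

Let sG n : sigma_algebra setT (G n). Proof. by case: fG. Qed.
Let GM n : G n `<=` @measurable _ Omega. Proof. by case: fG. Qed.
Let mNO n : measurable_fun [set: Omega] (N n).
Proof. exact: (measurable_fun_sub_sigma (sG n) (@GM n)). Qed.
Let mNE n A : measurable A -> measurable_fun A (EFin \o N n).
Proof. by move=> mA; apply/measurable_EFinP; exact: measurable_funTS. Qed.

Let GT n : G n setT.
Proof. by apply/(measurable_sub_sigma (sG n)); exact: measurableT. Qed.

Let intN n : (\int[P]_w (N n w)%:E <= \int[P]_w (N 0%N w)%:E)%E.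
Proof. by elim: n => // n; apply: le_trans; apply: superN; exact: GT. Qed.

Let A a b k := [set w | holding a b (N^~ w) k].

Let GA a b k : G k (A a b k).
Proof.
have GO m B : @measurable _ (g_sigma_algebraType (G m)) B -> G m B.
  by move/(measurable_sub_sigma (sG m)).
have itvO m (i : interval R) : G m [set w | N m w \in i].
  by apply: GO; have := @mN m measurableT _ (measurable_itv i); rewrite setTI.
elim: k => [|k ih].
  rewrite (_ : A a b 0 = [set w | N 0%N w \in `]-oo, a[]); first exact: itvO.
  by apply/seteqP; split => w /=; rewrite in_itv.
rewrite (_ : A a b k.+1 = (A a b k `&` [set w | N k.+1 w \in `]-oo, b]]) `|`
   (~` A a b k `&` [set w | N k.+1 w \in `]-oo, a[])); last first.
  apply/seteqP; split => w; rewrite /A /= !in_itv/=.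
    by case: ifPn => h ?; [left|right].
  by move=> [[-> //]|[/negP/negbTE -> //]].
have mA : @measurable _ (g_sigma_algebraType (G k.+1)) (A a b k).
  apply/(measurable_sub_sigma (sG k.+1)).
  by case: fG => _ _; apply.
apply: GO; apply: measurableU; apply: measurableI => //.
- by apply/(measurable_sub_sigma (sG k.+1)); exact: itvO.
- exact: measurableC.
- by apply/(measurable_sub_sigma (sG k.+1)); exact: itvO.
Qed.

Let mA a b k : measurable (A a b k). Proof. exact/GM/GA. Qed.

Let mhold a b k : measurable_fun [set: Omega]
  (fun w => (holding a b (N^~ w) k)%:R : R).
Proof.
rewrite (_ : (fun _ => _) = \1_(A a b k)); first exact: measurable_indic.
apply/funext => w; rewrite indicE; congr (_ %:R).
case: (boolP (holding _ _ _ _)) => h; first by rewrite mem_set.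
by rewrite memNset//; exact/negP.
Qed.

Let U a b k w : R := (upcrossing a b (N^~ w) k)%:R.

Let mU a b k : measurable_fun [set: Omega] (U a b k).
Proof.
rewrite (_ : U a b k = (fun w => (holding a b (N^~ w) k)%:R *
  (1 - (holding a b (N^~ w) k.+1)%:R))).
  apply: measurable_funM => //; apply: measurable_funB => //; exact: mhold.
apply/funext => w; rewrite /U /upcrossing.
by case: holding; case: holding => /=; lra.
Qed.

(** The strategy has nonpositive expected gain on a supermartingale. *)
Lemma upcrossing_integral a b n : 0 <= a -> a < b ->
  (\int[P]_w (\sum_(0 <= k < n) U a b k w)%:E <= (a / (b - a))%:E)%E.
Proof.
move=> a0 ab.
pose S := (\sum_(0 <= k < n) \int[P]_(w in A a b k) (N k w)%:E)%E.
have hE (v : Omega -> R) k w : ((holding a b (N^~ w) k)%:R * v w)%:E =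
    ((EFin \o v) \_ (A a b k)) w.
  rewrite patchE; case: (boolP (holding a b (N^~ w) k)) => h.
    by rewrite mem_set//= mul1r.
  by rewrite memNset ?mul0r//=; exact/negP.
have hint m k : (\int[P]_w ((holding a b (N^~ w) k)%:R * N m w)%:E =
    \int[P]_(w in A a b k) (N m w)%:E)%E.
  by rewrite [RHS]integral_mkcond; apply: eq_integral => w _; rewrite hE.
have mh m k : measurable_fun [set: Omega]
    (fun w => ((holding a b (N^~ w) k)%:R * N m w)%:E).
  by apply/measurable_EFinP; apply: measurable_funM.
have h0 m k w : 0 <= (holding a b (N^~ w) k)%:R * N m w by rewrite mulr_ge0.
have Sint : (\int[P]_w (\sum_(0 <= k < n) (holding a b (N^~ w) k)%:R * N k w)%:E
    = S)%E.
  under eq_integral do rewrite -sumEFin.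
  rewrite ge0_integral_sum//; last by move=> k w _; rewrite lee_fin.
  by apply: eq_bigr => k _; rewrite hint.
have Sint1 : (\int[P]_w (\sum_(0 <= k < n) (holding a b (N^~ w) k)%:R * N k.+1 w)%:E
    <= S)%E.
  under eq_integral do rewrite -sumEFin.
  rewrite ge0_integral_sum//; last by move=> k w _; rewrite lee_fin.
  by apply: lee_sum => k _; rewrite hint; apply: superN; exact: GA.
have Sfin : S \is a fin_num.
  apply/sum_fin_numP => k _ _; rewrite ge0_fin_numE; last first.
    by apply: integral_ge0 => w _; rewrite lee_fin.
  apply: le_lt_trans (le_lt_trans (intN k) intN0).
  apply: ge0_subset_integral => //; first exact: mNE.
  by move=> w _; rewrite lee_fin.
have msum (v : nat -> Omega -> R) : (forall k, measurable_fun setT (v k)) ->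
    measurable_fun [set: Omega] (fun w => (\sum_(0 <= k < n) v k w)%:E).
  by move=> mv; apply/measurable_EFinP; exact: measurable_sum.
have sU0 w : 0 <= \sum_(0 <= k < n) U a b k w by exact: sumr_ge0.
have key : ((b - a)%:E * \int[P]_w (\sum_(0 <= k < n) U a b k w)%:E + S <= a%:E + S)%E.
  rewrite -ge0_integralZl_EFin//; last 3 first.
  - by move=> w _; rewrite lee_fin.
  - exact: msum.
  - by rewrite subr_ge0 ltW.
  rewrite -[in leLHS]Sint -ge0_integralD//; last 4 first.
  - by move=> w _; rewrite -EFinM lee_fin mulr_ge0// subr_ge0 ltW.
  - apply: emeasurable_funM => //; exact: msum.
  - by move=> w _; rewrite lee_fin sumr_ge0.
  - by apply: msum => k; exact: measurable_funM.
  apply: (@le_trans _ _ (\int[P]_w (a%:E +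
      (\sum_(0 <= k < n) (holding a b (N^~ w) k)%:R * N k.+1 w)%:E))%E).
    apply: ge0_le_integral => //.
    - move=> w _; rewrite -EFinM -EFinD lee_fin addr_ge0 ?sumr_ge0//.
      by rewrite mulr_ge0// subr_ge0 ltW.
    - apply: emeasurable_funD; first by apply: emeasurable_funM => //; exact: msum.
      by apply: msum => k; exact: measurable_funM.
    - apply: emeasurable_funD => //.
      by apply: msum => k; exact: measurable_funM.
    - move=> w _; rewrite -EFinM -!EFinD lee_fin.
      exact: upcrossing_gain.
  rewrite ge0_integralD//; last 2 first.
  - by move=> w _; rewrite lee_fin sumr_ge0.
  - by apply: msum => k; exact: measurable_funM.
  rewrite integral_cst// [X in (a%:E * X)%E](_ : _ = 1%E) ?mule1; last exact: probability_setT.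
  by rewrite leeD2l.
rewrite leeD2rE// in key.
by rewrite EFinM lee_pdivlMr ?subr_gt0// muleC.
Qed.

(** Finitely many upcrossings of every rational interval exclude oscillation, and
Fatou's lemma excludes divergence to infinity. *)
Lemma nonneg_supermartingale_cvg : {ae P, forall w, cvgn (N^~ w)}.
Proof.
have UE : {ae P, forall w, forall qr : rat * rat,
    0 <= ratr qr.1 :> R -> qr.1 < qr.2 ->
    (\sum_(0 <= k <oo) (U (ratr qr.1) (ratr qr.2) k w)%:E < +oo)%E}.
  apply: ae_forall_countable => -[q r] /=.
  have [q0|q0] := leP 0 (ratr q : R); last by apply: aeW.
  have [qr|qr] := ltP q r; last by apply: aeW.
  have mUE k : measurable_fun [set: Omega] (fun w => (U (ratr q) (ratr r) k w)%:E).
    exact/measurable_EFinP.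
  have U0 k w : (0 <= (U (ratr q) (ratr r) k w)%:E)%E by rewrite lee_fin.
  suff : {ae P, forall w,
      (\sum_(0 <= k <oo) (U (ratr q) (ratr r) k w)%:E < +oo)%E}.
    by apply: filterS => w ? _ _.
  apply: ae_lty_integral.
  - by apply: ge0_emeasurable_sum.
  - by move=> w; exact: nneseries_ge0.
  rewrite integral_nneseries//.
  apply: (@le_lt_trans _ _ (ratr q / (ratr r - ratr q))%:E); last exact: ltry.
  apply: lime_le; first by apply: is_cvg_nneseries => k _ _; exact: integral_ge0.
  apply: nearW => n; rewrite -ge0_integral_sum//.
  under eq_integral do rewrite sumEFin.
  by apply: upcrossing_integral; rewrite ?ltr_rat.
have liminfN : {ae P, forall w, (limn_einf (fun n => (N n w)%:E) < +oo)%E}.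
  apply: ae_lty_integral.
  - under eq_fun do rewrite limn_einf_lim.
    apply: (emeasurable_fun_cvg (fun n w => einfs (fun n => (N n w)%:E) n)).
      by move=> n; apply: measurable_fun_einfs => m; exact: mNE.
    by move=> w _; exact: is_cvg_einfs.
  - move=> w; rewrite limn_einf_lim; apply: lime_ge; first exact: is_cvg_einfs.
    by apply: nearW => n; apply: le_ereal_inf_tmp => _ [k _ <-]; rewrite lee_fin.
  apply: le_lt_trans (fatou P measurableT _ _) _.
  - by move=> n; exact: mNE.
  - by move=> n w _; rewrite lee_fin.
  apply: le_lt_trans intN0; rewrite limn_einf_lim.
  apply: lime_le; first exact: is_cvg_einfs.
  apply: nearW => n; apply: le_trans (intN n).
  by apply: ereal_inf_lbound; exists n => /=.
apply: filterS2 UE liminfN => w Uw Nw.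
have [M NM] : exists M : R, ~ (\forall n \near \oo, M <= N n w).
  apply: contrapT => /forallNP H.
  have NE : (N n w)%:E @[n --> \oo] --> +oo%E.
    by apply/cvgeryP/cvgryPge => M; apply: contrapT; exact: H.
  by move: Nw; rewrite (cvg_limn_einf_sup NE).
apply: (is_cvg_no_oscillation _ NM) => // q r q0 qr.
apply: finite_upcrossing_dichotomy; exact: (Uw (q, r)).
Qed.

End supermartingale.

(** * The Robbins-Siegmund theorem *)

Lemma integral_indicM d (Omega : measurableType d) (R : realType)
    (mu : {measure set Omega -> \bar R}) (A : set Omega) (f : Omega -> R) :
  (\int[mu]_(w in A) (f w)%:E = \int[mu]_w (\1_A w * f w)%:E)%E.
Proof.
rewrite integral_mkcond; apply: eq_integral => w _.
by rewrite patchE indicE; case: ifPn => _; rewrite ?mul1r ?mul0r.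
Qed.

Lemma prod_le_expR_sum (R : realType) (u : nat -> R) n :
  (forall k, 0 <= u k) ->
  \prod_(0 <= k < n) (1 + u k) <= expR (\sum_(0 <= k < n) u k).
Proof.
move=> u0; elim: n => [|n ih]; first by rewrite !big_geq// expR0.
rewrite !big_nat_recr//= expRD ler_pM//.
- by apply: prodr_ge0 => k _; rewrite addr_ge0.
- by rewrite addr_ge0.
- exact: expR_ge1Dx.
Qed.

Lemma measurable_inv_gt0 d (T : measurableType d) (R : realType) (f : T -> R) :
  (forall w, 0 < f w) -> measurable_fun setT f ->
  measurable_fun setT (fun w => (f w)^-1).
Proof.
move=> f0 mf; rewrite (_ : (fun w => _) = (fun w => f w `^ (-1))).
  exact: (measurableT_comp (measurable_powR (-1)) mf).
by apply/funext => w; rewrite powR_inv1// ltW.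
Qed.

Section robbins_siegmund.
Context d {Omega : measurableType d} {R : realType}.
Variables (P : probability Omega R) (G : nat -> set (set Omega)).
Variables (alpha mu nu : nat -> Omega -> R) (theta : nat -> Omega -> \bar R).
Local Notation measG n f := (measurable_fun [set: g_sigma_algebraType (G n)]
  (f : g_sigma_algebraType (G n) -> _)).
Hypothesis fG : filtration G.
Hypotheses (malpha : forall n, measG n (alpha n))
  (mmu : forall n, measG n (mu n)) (mnu : forall n, measG n (nu n))
  (mtheta : forall n, measurable_fun [set: Omega] (theta n)).
Hypotheses (alpha0 : forall n w, 0 <= alpha n w) (mu0 : forall n w, 0 <= mu n w)
  (nu0 : forall n w, 0 <= nu n w) (theta0 : forall n w, (0 <= theta n w)%E).
(** Testing against the weights known at time n expresses a conditional inequality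
without requiring integrability. *)
Hypothesis decrease : forall n (phi : Omega -> R), measG n phi ->
  (forall w, 0 <= phi w) ->
  (\int[P]_w (phi w * alpha n.+1 w)%:E + \int[P]_w ((phi w)%:E * theta n w)
   <= \int[P]_w (phi w * ((1 + mu n w) * alpha n w + nu n w))%:E)%E.

Let sG n : sigma_algebra setT (G n). Proof. by case: fG. Qed.
Let GM n : G n `<=` @measurable _ Omega. Proof. by case: fG. Qed.

(* Dividing by B removes the factors 1 + mu_n; C is the accumulated drift that
   remains.  Both are predictable: their values at n.+1 are known at time n. *)
Let B n w : R := \prod_(0 <= k < n) (1 + mu k w).
Let C n w : R := \sum_(0 <= k < n) nu k w / B k.+1 w.

Let B_gt0 n w : 0 < B n w.
Proof. by apply: prodr_gt0 => k _; rewrite ltr_pwDl. Qed.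

Let BS n w : B n.+1 w = B n w * (1 + mu n w).
Proof. by rewrite /B big_nat_recr. Qed.

Let B_ge1 n w : 1 <= B n w.
Proof.
elim: n => [|n ih]; first by rewrite /B big_geq.
by rewrite BS (le_trans ih)// ler_peMr ?ler_wpDr// ltW.
Qed.

Let CS n w : C n.+1 w = C n w + nu n w / B n.+1 w.
Proof. by rewrite /C big_nat_recr. Qed.

Let CleS n w : C n w <= C n.+1 w.
Proof. by rewrite CS lerDl divr_ge0// ltW. Qed.

Let up m n (f : Omega -> R) : (m <= n)%N -> measG m f -> measG n f.
Proof. by move=> mn; exact: measurable_fun_filtration. Qed.

Let mBS n : measG n (B n.+1).
Proof.
elim: n => [|n ih].
  rewrite (_ : B 1%N = fun w => 1 + mu 0%N w); first exact: measurable_funD.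
  by apply/funext => w; rewrite BS /B big_geq// mul1r.
rewrite (_ : B n.+2 = fun w => B n.+1 w * (1 + mu n.+1 w)).
  apply: measurable_funM; first exact: up (leqnSn n) ih.
  exact: measurable_funD.
by apply/funext => w; rewrite BS.
Qed.

Let mCS n : measG n (C n.+1).
Proof.
elim: n => [|n ih].
  rewrite (_ : C 1%N = fun w => nu 0%N w / B 1%N w).
    by apply: measurable_funM => //; exact: measurable_inv_gt0.
  by apply/funext => w; rewrite CS /C big_geq// add0r.
rewrite (_ : C n.+2 = fun w => C n.+1 w + nu n.+1 w / B n.+2 w).
  apply: measurable_funD; first exact: up (leqnSn n) ih.
  by apply: measurable_funM => //; exact: measurable_inv_gt0.
by apply/funext => w; rewrite CS.
Qed.

Let mB n : measG n (B n).
Proof.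
case: n => [|n]; last exact: up (leqnSn n) (@mBS n).
rewrite (_ : B 0%N = cst 1); first exact: measurable_cst.
by apply/funext => w; rewrite /B big_geq.
Qed.

Let mC n : measG n (C n).
Proof.
case: n => [|n]; last exact: up (leqnSn n) (@mCS n).
rewrite (_ : C 0%N = cst 0); first exact: measurable_cst.
by apply/funext => w; rewrite /C big_geq.
Qed.

(* On the event D n the initial value and the accumulated drift are at most c, so
   the compensated process N is nonnegative and integrable; killing N outside the
   decreasing events D n plays the role of a stopping time. *)
Section localization.
Variable c : R.
Hypothesis c0 : 0 <= c.

Let D n : set Omega := [set w | alpha 0%N w <= c] `&` [set w | C n w <= c].
Let J n : Omega -> R := \1_(D n).

Let J0 n w : 0 <= J n w. Proof. by rewrite /J indicE. Qed.

Let mJ_of m n : measG m (C n) -> measG m (J n).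
Proof.
move=> mCn; apply: measurable_indic; apply: measurableI.
  have := up (leq0n m) (@malpha 0) measurableT (measurable_itv `]-oo, c]).
  by rewrite setTI; congr (measurable _); apply/seteqP; split => w /=; rewrite in_itv.
have := mCn measurableT _ (measurable_itv `]-oo, c]).
by rewrite setTI; congr (measurable _); apply/seteqP; split => w /=; rewrite in_itv.
Qed.

Let mJ n : measG n (J n). Proof. exact: mJ_of (@mC n). Qed.
Let mJS n : measG n (J n.+1). Proof. exact: mJ_of (@mCS n). Qed.

Let N n w : R := J n w * (alpha n w / B n w + (c - C n w)).

Let JleS n w : J n.+1 w <= J n w.
Proof.
rewrite /J !indicE ler_nat; case: (boolP (w \in D n.+1)) => //.
rewrite inE => -[ac Cc]; rewrite mem_set//; split => //.
by apply: le_trans Cc; exact: CleS.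
Qed.

Let JC_ge0 n w : 0 <= J n w * (c - C n w).
Proof.
rewrite /J indicE; case: (boolP (w \in D n)) => [|_]; last by rewrite mul0r.
by rewrite inE => -[_ Cc]; rewrite mul1r subr_ge0.
Qed.

Let N0 n w : 0 <= N n w.
Proof.
by rewrite /N mulrDr addr_ge0// mulr_ge0// divr_ge0// ltW.
Qed.

Let mN n : measG n (N n).
Proof.
apply: measurable_funM => //; apply: measurable_funD.
  by apply: measurable_funM => //; exact: measurable_inv_gt0.
exact: measurable_funB.
Qed.

Let toO n (f : Omega -> R) : measG n f -> measurable_fun [set: Omega] f.
Proof. exact: (measurable_fun_sub_sigma (sG n) (@GM n)). Qed.

Let J_drop n w : J n.+1 w * (alpha n w / B n w + (c - C n w)) <= N n w.
Proof.
rewrite /N; rewrite {1}/J indicE; case: (boolP (w \in D n.+1)) => [|_].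
  rewrite inE => -[ac Cc].
  have := JC_ge0 n w; rewrite /J indicE mem_set ?mul1r//.
  by split => //=; apply: le_trans Cc; exact: CleS.
by rewrite mul0r; exact: N0.
Qed.

(* Supermartingale property of N; the surplus term gives the summability of
   theta, by taking A to be everything and telescoping. *)
Let N_decrease n (A : set Omega) : G n A ->
  (\int[P]_(w in A) (N n.+1 w)%:E +
   \int[P]_w ((\1_A w * (J n.+1 w / B n.+1 w))%:E * theta n w)
   <= \int[P]_(w in A) (N n w)%:E)%E.
Proof.
move=> GA; pose phi w : R := \1_A w * (J n.+1 w / B n.+1 w).
have mA : measG n (\1_A : Omega -> R).
  by apply: measurable_indic; exact/(measurable_sub_sigma (sG n)).
have mphi : measG n phi.
  by apply: measurable_funM => //; apply: measurable_funM => //; exact: measurable_inv_gt0.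
have phi0 w : 0 <= phi w by rewrite mulr_ge0// ?indicE// divr_ge0// ltW.
pose h w : R := \1_A w * (J n.+1 w * (c - C n.+1 w)).
have h0 w : 0 <= h w by rewrite mulr_ge0// indicE.
have mh : measG n h.
  apply: measurable_funM => //; apply: measurable_funM => //.
  exact: measurable_funB.
have mphi' := toO mphi; have mh' := toO mh.
have malpha' := toO (@malpha n.+1).
have mrhs : measurable_fun [set: Omega]
    (fun w => phi w * ((1 + mu n w) * alpha n w + nu n w)).
  apply: measurable_funM => //; apply: measurable_funD; last exact: toO (@mnu n).
  apply: measurable_funM; last exact: toO (@malpha n).
  by apply: measurable_funD => //; exact: toO (@mmu n).
have rhs0 w : 0 <= phi w * ((1 + mu n w) * alpha n w + nu n w).
  by rewrite mulr_ge0// addr_ge0// mulr_ge0// addr_ge0.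
rewrite [in leLHS]integral_indicM [leRHS]integral_indicM.
have -> : (\int[P]_w (\1_A w * N n.+1 w)%:E =
    \int[P]_w (phi w * alpha n.+1 w)%:E + \int[P]_w (h w)%:E)%E.
  rewrite -ge0_integralD//.
  - by apply: eq_integral => w _; rewrite -EFinD /N /phi /h; congr EFin; ring.
  - by move=> w _; rewrite lee_fin mulr_ge0.
  - by apply/measurable_EFinP; exact: measurable_funM.
  - by move=> w _; rewrite lee_fin.
  - exact/measurable_EFinP.
rewrite addeAC; apply: (@le_trans _ _
   (\int[P]_w (phi w * ((1 + mu n w) * alpha n w + nu n w))%:E +
    \int[P]_w (h w)%:E)%E).
  by rewrite leeD2r// decrease.
rewrite -ge0_integralD//; last 4 first.
- by move=> w _; rewrite lee_fin.
- exact/measurable_EFinP.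
- by move=> w _; rewrite lee_fin.
- exact/measurable_EFinP.
apply: ge0_le_integral => //.
- by move=> w _; rewrite -EFinD lee_fin addr_ge0.
- by apply/measurable_EFinP; exact: measurable_funD.
- apply/measurable_EFinP; apply: measurable_funM; first exact: toO mA.
  exact: toO (@mN n).
move=> w _; rewrite -EFinD lee_fin /phi /h -!mulrA -mulrDr.
rewrite ler_wpM2l ?indicE//; apply: le_trans (J_drop n w).
rewrite -mulrDr ler_wpM2l// CS BS invfM.
have b0 : B n w != 0 by rewrite gt_eqF.
have m0 : 1 + mu n w != 0 by rewrite gt_eqF// ltr_pwDl.
rewrite le_eqVlt; apply/orP; left; apply/eqP; field.
by rewrite b0 m0.
Qed.

Let intN0 : (\int[P]_w (N 0%N w)%:E <= (c + c)%:E)%E.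
Proof.
have -> : (c + c)%:E = (\int[P]_w (cst (c + c)%:E w))%E.
  rewrite integral_cst// [X in (_ * X)%E](_ : _ = 1%E) ?mule1//.
  exact: probability_setT.
apply: ge0_le_integral => //.
- by move=> w _; rewrite lee_fin.
- by apply/measurable_EFinP; exact: toO (@mN 0).
- move=> w _; rewrite lee_fin /N /J indicE.
  case: (boolP (w \in D 0)) => [|_]; last by rewrite mul0r addr_ge0.
  rewrite inE => -[+ _] /=.
  by rewrite /B /C !big_geq// divr1 subr0 mul1r => ac; rewrite lerD2r.
Qed.

Let theta_ge0 n A w :
  (0 <= (\1_A w * (J n.+1 w / B n.+1 w))%:E * theta n w)%E.
Proof.
rewrite mule_ge0// lee_fin mulr_ge0 ?indicE//.
by rewrite divr_ge0// ltW.
Qed.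

Lemma localized_cvg : {ae P, forall w, cvgn (N^~ w)}.
Proof.
apply: (nonneg_supermartingale_cvg fG) => //.
- exact: le_lt_trans intN0 (ltry _).
- move=> n A GA; apply: le_trans (N_decrease GA).
  by rewrite leeDl//; apply: integral_ge0 => w _; exact: theta_ge0.
Qed.

Lemma localized_series :
  {ae P, forall w, (\sum_(0 <= n <oo) (J n.+1 w / B n.+1 w)%:E * theta n w < +oo)%E}.
Proof.
have GT n : G n setT.
  by apply/(measurable_sub_sigma (sG n)); exact: measurableT.
have t0 n w : (0 <= (J n.+1 w / B n.+1 w)%:E * theta n w)%E.
  by rewrite mule_ge0// lee_fin divr_ge0// ltW.
have mt n : measurable_fun [set: Omega] (fun w => ((J n.+1 w / B n.+1 w)%:E * theta n w)%E).
  apply: emeasurable_funM => //; apply/measurable_EFinP; apply: (@toO n).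
  by apply: measurable_funM => //; exact: measurable_inv_gt0.
apply: ae_lty_integral.
- by apply: ge0_emeasurable_sum.
- by move=> w; exact: nneseries_ge0.
rewrite integral_nneseries//; apply: le_lt_trans (ltry (c + c)).
apply: lime_le; first by apply: is_cvg_nneseries => k _ _; exact: integral_ge0.
apply: nearW => n; apply: le_trans intN0.
apply: (@le_trans _ _ (\int[P]_w (N n w)%:E + \sum_(0 <= k < n)
   \int[P]_w ((J k.+1 w / B k.+1 w)%:E * theta k w))%E).
  by rewrite leeDr//; apply: integral_ge0 => w _; rewrite lee_fin.
elim: n => [|n ih]; first by rewrite big_geq// adde0.
apply: le_trans ih; rewrite big_nat_recr//= addeCA addeC leeD2r//.
apply: le_trans (N_decrease (GT n)); rewrite leeD2l//.
by under [leRHS]eq_integral do rewrite indicT mul1r.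
Qed.

End localization.

Hypothesis sum_mu : {ae P, forall w, (\sum_(0 <= n <oo) (mu n w)%:E < +oo)%E}.
Hypothesis sum_nu : {ae P, forall w, (\sum_(0 <= n <oo) (nu n w)%:E < +oo)%E}.

(** Almost every path stays in the localizing events of some level c, on which B
is bounded by exp of the sum of mu and everything can be undone. *)
Lemma robbins_siegmund :
  {ae P, forall w, cvgn (alpha^~ w) /\ (\sum_(0 <= n <oo) theta n w < +oo)%E}.
Proof.
have ae1 : {ae P, forall w, forall c : nat, cvgn (fun n =>
    (\1_([set w | alpha 0%N w <= c%:R] `&` [set w | C n w <= c%:R]) w : R) *
      (alpha n w / B n w + (c%:R - C n w)))}.
  by apply: ae_forall_countable => c; exact: localized_cvg.
have ae2 : {ae P, forall w, forall c : nat, (\sum_(0 <= n <oo)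
    ((\1_([set w | alpha 0%N w <= c%:R] `&` [set w | C n.+1 w <= c%:R]) w : R)
      / B n.+1 w)%:E * theta n w < +oo)%E}.
  by apply: ae_forall_countable => c; exact: localized_series.
apply: filter_app sum_mu; apply: filterS3 sum_nu ae1 ae2 => w.
move=> /(nneseries_ltyP (fun=> nu0 _ _))[V nuV] cvgN serN.
move=> /(nneseries_ltyP (fun=> mu0 _ _))[M muM].
have BM n : B n w <= expR M.
  by apply: le_trans (prod_le_expR_sum _ _) _; rewrite ?ler_expR.
have CV n : C n w <= V.
  apply: le_trans (nuV n); apply: ler_sum => k _.
  by rewrite ler_pdivrMr// ler_peMr.
have [c [ac Vc]] : exists c : nat, alpha 0%N w <= c%:R /\ V <= c%:R.
  exists (Num.truncn (Num.max (alpha 0%N w) V)).+1.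
  by split; apply: le_trans (ltW (truncnS_gt _)); rewrite le_max lexx ?orbT.
have J1 n : \1_([set w | alpha 0%N w <= c%:R] `&` [set w | C n w <= c%:R]) w = 1 :> R.
  by rewrite indicE mem_set//; split => //=; exact: le_trans (CV n) Vc.
split.
  have {}cvgN : cvgn (fun n => alpha n w / B n w + (c%:R - C n w)).
    by have := cvgN c; under eq_fun do rewrite J1 mul1r.
  have cC : cvgn (C^~ w).
    apply: nondecreasing_is_cvgn; last by exists V => _ [n _ <-].
    by apply/nondecreasing_seqP => n; exact: CleS.
  have cB : cvgn (B^~ w).
    apply: nondecreasing_is_cvgn; last by exists (expR M) => _ [n _ <-].
    by apply/nondecreasing_seqP => n; rewrite BS ler_peMr ?lerDl// (ltW (B_gt0 _ _)).
  rewrite (_ : alpha^~ w = fun n =>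
      (alpha n w / B n w + (c%:R - C n w) - (c%:R - C n w)) * B n w).
    have cc : cvgn (fun n => c%:R - C n w) by exact: (is_cvgB (is_cvg_cst _) cC).
    exact: (is_cvgM (is_cvgB cvgN cc) cB).
  by apply/funext => n; rewrite addrK divfK// gt_eqF.
have {}serN : (\sum_(0 <= n <oo) ((B n.+1 w)^-1)%:E * theta n w < +oo)%E.
  have := serN c; congr (_ < _)%E; apply: eq_eseriesr => n _.
  by rewrite J1 mul1r.
have s0 n : (0 <= ((B n.+1 w)^-1)%:E * theta n w)%E.
  by rewrite mule_ge0// lee_fin invr_ge0 ltW.
apply: (@le_lt_trans _ _
    ((expR M)%:E * \sum_(0 <= n <oo) ((B n.+1 w)^-1)%:E * theta n w)%E).
  rewrite -nneseriesZl//; apply: lee_nneseries => n _ //.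
  rewrite muleA -EFinM -[leLHS]mul1e lee_wpmul2r// lee_fin.
  by rewrite ler_pdivlMr// mul1r.
by apply: lte_mul_pinfty => //; rewrite lee_fin ltW// expR_gt0.
Qed.

End robbins_siegmund.

(** * Weak convergence in a separable Hilbert space *)

Section sequences_and_filters.

(** Recursive extraction: the j-th index satisfies the j-th of a list of
properties, each of which holds at arbitrarily large indices. *)
Lemma subsequence_of_frequently (Q : nat -> nat -> Prop) :
  (forall j m, exists2 n, (m <= n)%N & Q j n) ->
  exists2 k, subsequence_index k & forall j, Q j (k j).
Proof.
move=> QE.
have /choice[f fQ] : forall jm : nat * nat, exists n, (jm.2 <= n)%N /\ Q jm.1 n.
  by move=> [j m]; have [n mn Qn] := QE j m; exists n.
pose k := fix k j := if j is i.+1 then f (j, (k i).+1) else f (0, 0)%N.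
exists k; last by case=> [|j]; [have [] := fQ (0, 0)%N|have [] := fQ (j.+1, (k j).+1)].
apply: (homo_ltn ltn_trans) => j.
by have [] := fQ (j.+1, (k j).+1).
Qed.

Lemma subsequence_index_cvgy k : subsequence_index k -> k @ \oo --> \oo.
Proof.
move=> ki; have kn n : (n <= k n)%N.
  by elim: n => // n ih; exact: leq_ltn_trans ih (ki _ _ (ltnSn n)).
move=> A [N _ NA]; exists N => // n /= Nn; apply: NA => /=.
exact: leq_trans Nn (kn n).
Qed.

Lemma ultra_fmap (T U : Type) (f : T -> U) (F : set_system T) :
  UltraFilter F -> UltraFilter (f @ F).
Proof.
move=> FU; split; first exact: fmap_proper_filter.
move=> G GF FG; apply/seteqP; split => // B GB.
have [//|FB] := in_ultra_setVsetC (f @^-1` B) FU.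
have GNB : G (~` B) by apply: FG.
by have [u []] := filter_ex (@filterI _ _ _ _ _ GB GNB).
Qed.

End sequences_and_filters.

Section hilbert.
Context {R : realType} {H : completeNormedModType R}.
Variable dot : {dot H for idfun}.
Hypothesis Hnorm : norm_from_dot dot.
Implicit Types u v w : H.

Lemma dotC u v : dot u v = dot v u.
Proof. by rewrite hermC /= expr0 mul1r. Qed.

Lemma sqr_normD u v : `|u + v| ^+ 2 = `|u| ^+ 2 + 2 * dot u v + `|v| ^+ 2.
Proof. by rewrite !Hnorm linearDl !linearDr /= (dotC v u); ring. Qed.

Lemma sqr_normB u v : `|u - v| ^+ 2 = `|u| ^+ 2 - 2 * dot u v + `|v| ^+ 2.
Proof. by rewrite !Hnorm linearBl !linearBr /= (dotC v u); ring. Qed.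

(** Cauchy-Schwarz, read off from the triangle inequality of the given norm. *)
Lemma dot_le_norm u v : `|dot u v| <= `|u| * `|v|.
Proof.
have D := ler_normD u v; have B := ler_normB u v.
have {}D : `|u + v| ^+ 2 <= (`|u| + `|v|) ^+ 2 by rewrite lerXn2r ?nnegrE// addr_ge0.
have {}B : `|u - v| ^+ 2 <= (`|u| + `|v|) ^+ 2 by rewrite lerXn2r ?nnegrE// addr_ge0.
rewrite sqr_normD in D; rewrite sqr_normB in B.
by rewrite ler_norml; apply/andP; split; lra.
Qed.

Lemma dot_cvg (T : Type) (F : set_system T) (FF : Filter F) (y : T -> H) l u :
  y @ F --> l -> dot (y t) u @[t --> F] --> (dot l u : R).
Proof.
move=> /cvgrPdist_lt yl; apply/cvgrPdist_lt => e e0.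
have u1 : 0 < `|u| + 1 by rewrite ltr_wpDl.
have := yl (e / (`|u| + 1)) (divr_gt0 e0 u1).
apply: filterS => t lyt; rewrite -linearBl.
apply: le_lt_trans (dot_le_norm _ _) _.
apply: (@le_lt_trans _ _ (`|l - y t| * (`|u| + 1))).
  by rewrite ler_wpM2l// lerDl.
by rewrite -ltr_pdivlMr.
Qed.

(** The representing vector minimizes J v = |v|^2 - 2 L v: minimizing sequences
are Cauchy by the parallelogram identity, and near the infimum of J the
defect of the first-order condition is controlled by the gap, so that it
vanishes in the limit. *)
Lemma riesz (L : H -> R) (M : R) :
  (forall u v, L (u + v) = L u + L v) -> (forall a u, L (a *: u) = a * L u) ->
  (forall u, `|L u| <= M * `|u|) -> exists l, forall u, L u = dot l u.
Proof.
move=> LD LZ LM.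
pose J v : R := `|v| ^+ 2 - 2 * L v.
have Jlb v : - M ^+ 2 <= J v.
  rewrite /J; have := LM v; rewrite ler_norml => /andP[_ Lv].
  have := sqr_ge0 (`|v| - M); nra.
have hJ : has_inf (range J).
  by split; [exists (J 0), 0|exists (- M ^+ 2) => _ [v _ <-]].
pose m := inf (range J).
have mJ v : m <= J v by apply: ge_inf; [case: hJ|exists v].
have /choice[y yJ] : forall n : nat, exists v, J v < m + n.+1%:R^-1.
  move=> n; have n0 : 0 < n.+1%:R^-1 :> R by rewrite invr_gt0.
  by have [_ [v _ <-] Jv] := inf_adherent n0 hJ; exists v.
have par v w : `|v - w| ^+ 2 <= 2 * (J v - m) + 2 * (J w - m).
  have := mJ (2^-1 *: (v + w)).
  rewrite sqr_normB /J normrZ exprMn sqr_normD LZ LD gtr0_norm ?invr_gt0//.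
  set p := `|v| ^+ 2; set q := `|w| ^+ 2; set r := dot v w; lra.
have near_lt (e : R) : 0 < e -> \forall n \near \oo, J (y n) - m < e.
  move=> e0; near=> n; rewrite ltrBlDl; apply: lt_trans (yJ n) _.
  rewrite ltrD2l; near: n; exact: near_infty_natSinv_lt (PosNum e0).
have yc : cvgn y.
  apply: cauchy_cvg; apply: cauchy_exP => e e0.
  have e2 : 0 < e ^+ 2 / 4 by rewrite divr_gt0// exprn_gt0.
  have [N _ NJ] := near_lt _ e2.
  exists (y N); exists N => // n /= Nn.
  rewrite -ball_normE /ball_/= -(ltr_pXn2r (ltn0Sn 1)) ?nnegrE ?(ltW e0)//.
  apply: le_lt_trans (par _ _) _.
  have := NJ _ (leqnn N); have := NJ _ Nn; rewrite /=; lra.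
exists (limn y) => u; pose q := `|u| ^+ 2 + 1.
have q0 : 0 < q by rewrite ltr_wpDl// sqr_ge0.
have dJ n : (dot (y n) u - L u) ^+ 2 <= (J (y n) - m) * q.
  set d := dot (y n) u - L u.
  (* Minimizing J along the line through y n directed by u, with |u|^2 replaced by
     q = |u|^2 + 1 so that the step is defined when u = 0. *)
  have := mJ (y n + (- d / q) *: u).
  rewrite /J sqr_normD LD LZ linearZr_LR /= normrZ exprMn real_normK ?num_real//.
  have -> : `|u| ^+ 2 = q - 1 by rewrite /q addrK.
  rewrite -ler_pdivrMr//; set p := `|y n| ^+ 2.
  have -> : d ^+ 2 / q = - (2 * (- d / q * d)) - d ^+ 2 / q by field; rewrite gt_eqF.
  have -> : (- d / q) ^+ 2 * (q - 1) = d ^+ 2 / q - (d / q) ^+ 2.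
    by field; rewrite gt_eqF.
  have := sqr_ge0 (d / q); rewrite /d; set s := dot (y n) u; set t := L u.
  set z := (_ / q); lra.
have c1 : dot (y n) u @[n --> \oo] --> (dot (limn y) u : R) by exact: dot_cvg.
have c2 : dot (y n) u @[n --> \oo] --> L u.
  apply/cvgrPdist_lt => e e0.
  have e2 : 0 < e ^+ 2 / q by rewrite divr_gt0// exprn_gt0.
  apply: filterS (near_lt _ e2) => n; rewrite ltr_pdivlMr// => Jn.
  rewrite distrC -(ltr_pXn2r (ltn0Sn 1)) ?nnegrE ?(ltW e0)//.
  by rewrite real_normK ?num_real//; exact: le_lt_trans (dJ n) Jn.
exact: (cvg_unique _ c2 c1).
Unshelve. all: by end_near. Qed.

End hilbert.

Section dense_sequences.
Context {R : realType} {H : completeNormedModType R}.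

(** A dense sequence of points of [F], rather than a countable dense subset, so
that it can index almost sure statements. *)
Definition dense_in (F : set H) (D : nat -> H) : Prop :=
  (forall i, F (D i)) /\
  forall z, F z -> forall e : R, 0 < e -> exists i, `|z - D i| < e.

Lemma separable_dense_in (F : set H) : separable H -> F !=set0 ->
  exists D, dense_in F D.
Proof.
move=> [S cS dS] [z0 Fz0].
have [x0 [_ Sx0]] : setT `&` S !=set0 by apply: dS; [exists 0|exact: openT].
have [s sE] : exists s : nat -> H, forall x, S x -> exists n, s n = x.
  move: cS; rewrite /countable => /pcard_surjP[s sS].
  by exists s => x /sS[n _ snx]; exists n.
have near_s z (e : R) : 0 < e -> exists n, `|z - s n| < e.
  move=> e0; have [x [zx /sE[n snx]]] : ball z e `&` S !=set0.
    by apply: dS; [exists z; exact: ballxx|exact: ball_open].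
  by exists n; move: zx; rewrite -ball_normE /ball_/= snx.
have /choice[f fP] : forall ij : nat * nat, exists z, F z /\
    ((exists2 z', F z' & `|z' - s ij.1| < ij.2.+1%:R^-1) ->
     `|z - s ij.1| < ij.2.+1%:R^-1).
  move=> [i j] /=.
  have [[z Fz zs]|nz] := pselect (exists2 z', F z' & `|z' - s i| < j.+1%:R^-1).
    by exists z.
  by exists z0; split.
exists (fun n => if unpickle n is Some ij then f ij else z0); split.
  by move=> n; case: unpickle => // ij; have [] := fP ij.
move=> z Fz e e0.
have e2 : 0 < e / 2 by rewrite divr_gt0.
have [j je] : exists j, j.+1%:R^-1 < e / 2.
  by near \oo => j; exists j; near: j; exact: near_infty_natSinv_lt (PosNum e2).
have [i zi] := near_s z j.+1%:R^-1 ltac:(by rewrite invr_gt0).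
exists (pickle (i, j)); rewrite pickleK.
have [_ /= /(_ _)fi] := fP (i, j).
have {}fi : `|f (i, j) - s i| < j.+1%:R^-1 by apply: fi; exists z.
rewrite -(subrK (s i) z) -addrA (le_lt_trans (ler_normD _ _))//.
rewrite [e]splitr ltrD// ?(lt_trans zi)// distrC ?(lt_trans fi)//.
Unshelve. all: by end_near. Qed.

(** The distance to y n is 1-Lipschitz in the target point, uniformly in n. *)
Lemma is_cvg_dist_dense_in (F : set H) (D : nat -> H) (y : nat -> H) :
  dense_in F D -> (forall i, cvgn (fun n => `|y n - D i|)) ->
  forall z, F z -> cvgn (fun n => `|y n - z|).
Proof.
move=> [_ DF] cD z Fz.
apply: cauchy_cvg; apply: cauchy_exP => e e0.
have e3 : 0 < e / 3 by rewrite divr_gt0.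
have [i zi] := DF z Fz _ e3.
have /cvg_ex[l /cvgrPdist_lt/(_ _ e3)yl] := cD i.
exists l; apply: filterS yl => n /= ln.
rewrite -ball_normE /ball_/=.
rewrite -(subrK `|y n - D i| l) -addrA (le_lt_trans (ler_normD _ _))//.
have h : `| `|y n - D i| - `|y n - z| | <= `|z - D i|.
  by apply: le_trans (ler_dist_dist _ _) _; rewrite opprB addrC addrA subrK.
by move: ln zi h; lra.
Qed.

End dense_sequences.

Section weak_convergence.
Context {R : realType} {H : completeNormedModType R}.
Variable dot : {dot H for idfun}.
Hypothesis Hnorm : norm_from_dot dot.
Implicit Types (u v w : H) (y : nat -> H).

Lemma weak_cvg_unique y p q : weak_cvg dot y p -> weak_cvg dot y q -> p = q.
Proof.
move=> yp yq; apply/eqP; rewrite -subr_eq0 -normr_eq0 -sqrf_eq0 Hnorm.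
rewrite linearBl subr_eq0; apply/eqP.
exact: cvg_unique (yp _) (yq _).
Qed.

Lemma strong_weak_cvg y p : y n @[n --> \oo] --> p -> weak_cvg dot y p.
Proof. by move=> yp u; exact: dot_cvg. Qed.

(** The forms dot (y n) are equi-Lipschitz, so a dense sequence of test points
suffices. *)
Lemma weak_cvg_dense y l (M : R) (s : nat -> H) :
  (forall n, `|y n| <= M) -> dense_in setT s ->
  (forall i, dot (y n) (s i) @[n --> \oo] --> (dot l (s i) : R)) ->
  weak_cvg dot y l.
Proof.
move=> yM [_ ds] ys u; apply/cvgrPdist_lt => e e0.
have M0 : 0 <= M by apply: le_trans (yM 0%N).
have K0 : 0 < M + `|l| + 1 by rewrite ltr_wpDl// addr_ge0.
have d0 : 0 < e / 2 / (M + `|l| + 1) by rewrite !divr_gt0.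
have [i ui] := ds u I _ d0.
have e2 : 0 < e / 2 by rewrite divr_gt0.
have /cvgrPdist_lt/(_ _ e2) := ys i; apply: filterS => n lyn.
have -> : dot l u - dot (y n) u = dot (l - y n) (u - s i) +
    (dot l (s i) - dot (y n) (s i)).
  by rewrite linearBr /= !linearBl subrK.
rewrite (le_lt_trans (ler_normD _ _))// [e]splitr ltrD//.
apply: le_lt_trans (dot_le_norm Hnorm _ _) _.
rewrite ltr_pdivlMr// mulrC in ui.
apply: le_lt_trans ui; rewrite ler_wpM2r//.
by have := ler_normB l (y n); have := yM n; lra.
Qed.

(** Along an ultrafilter all the bounded scalar sequences of inner products
converge at once, and their limit is a bounded linear form, represented by some l.
Every condition of closeness to l on finitely many points of a dense sequence
then holds at arbitrarily large indices, which lets one extract a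
subsequence. *)
Lemma weak_compact y (M : R) : separable H -> (forall n, `|y n| <= M) ->
  exists l, weak_cluster dot y l.
Proof.
move=> sepH yM.
have [s ds] := separable_dense_in sepH (ex_intro setT (0 : H) I).
have [U [UU ooU]] := ultraFilterLemma (@eventually_filter).
have UP : ProperFilter U by exact: ultra_proper.
have /choice[L yL] : forall u, exists r : R, dot (y n) u @[n --> U] --> r.
  move=> u; have := @segment_compact R (- (M * `|u|)) (M * `|u|).
  rewrite compact_ultra => /(_ ((fun n => dot (y n) u : R) @ U)).
  case=> [||r [_ yr]]; [exact: ultra_fmap| |by exists r].
  suff : \forall n \near U, `[- (M * `|u|), M * `|u|]%classic (dot (y n) u) by [].
  apply: filterE => n /=.
  rewrite in_itv/= -ler_norml (le_trans (dot_le_norm Hnorm _ _))//.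
  by rewrite ler_wpM2r.
have Luniq u (r : R) : dot (y n) u @[n --> U] --> r -> L u = r.
  exact: (cvg_unique _ (yL u)).
have [||u|l Ll] := riesz Hnorm (L := L) (M := M).
- move=> u v; apply: Luniq; under eq_fun do rewrite linearDr.
  exact: (cvgD (yL u) (yL v)).
- move=> a u; apply: Luniq; under eq_fun do rewrite linearZr_LR /=.
  exact: (cvgM (cvg_cst a) (yL u)).
- have yuM : \forall n \near U, `|dot (y n) u| <= M * `|u|.
    apply: filterE => n.
    by rewrite (le_trans (dot_le_norm Hnorm _ _))// ler_wpM2r.
  have nL : `|dot (y n) u| @[n --> U] --> `|L u| by exact: cvg_norm.
  by apply: (closed_cvg (fun r => r <= M * `|u|) _ yuM _ nL); exact: closed_le.
have [j m|k ki kP] := @subsequence_of_frequently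
  (fun j n => forall i, (i <= j)%N -> `|dot l (s i) - dot (y n) (s i)| < j.+1%:R^-1).
  have Um : U [set n | (m <= n)%N] by apply: ooU; exists m.
  have j0 : 0 < j.+1%:R^-1 :> R by rewrite invr_gt0.
  suff Ui : U [set n | forall i, (i <= j)%N ->
      `|dot l (s i) - dot (y n) (s i)| < j.+1%:R^-1].
    by have [n [mn Qn]] := filter_ex (@filterI _ _ _ _ _ Um Ui); exists n.
  have Ui i : U [set n | `|dot l (s i) - dot (y n) (s i)| < j.+1%:R^-1].
    by have /cvgrPdist_lt/(_ _ j0) := yL (s i); rewrite Ll.
  elim: {-2}j => [|j' ih].
    by apply: filterS (Ui 0%N) => n /= ? i; rewrite leqn0 => /eqP ->.
  apply: filterS (@filterI _ _ _ _ _ ih (Ui j'.+1)) => n /= [ih1 ih2] i.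
  by rewrite leq_eqVlt => /predU1P[->//|]; exact: ih1.
exists l, k => //; apply: (@weak_cvg_dense _ _ M s) => // i.
apply/cvgrPdist_lt => e e0; near=> n.
apply: lt_trans (kP n i _) _; first by near: n; exists i.
by near: n; exact: near_infty_natSinv_lt (PosNum e0).
Unshelve. all: by end_near. Qed.

Lemma weak_cluster_sub y k : subsequence_index k ->
  weak_cluster dot (y \o k) `<=` weak_cluster dot y.
Proof.
move=> ki l [j ji yl]; exists (k \o j) => // m n mn.
by apply: ki; exact: ji.
Qed.

(** If p and q are weak cluster points in F, the difference of the squared
distances to p and q is affine in y n and converges, so the inner product of y n
with q - p has a limit, which both p and q realize; hence p = q.  With
boundedness, uniqueness of the cluster point gives convergence. *)
Lemma opial y (F : set H) : separable H -> F !=set0 ->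
  (forall z, F z -> cvgn (fun n => `|y n - z|)) -> weak_cluster dot y `<=` F ->
  exists2 l, F l & weak_cvg dot y l.
Proof.
move=> sepH [z0 Fz0] cF WF.
have [M yM] : exists M : R, forall n, `|y n| <= M.
  have /cvg_seq_bounded[M [_ bM]] := cF z0 Fz0.
  exists (M + 1 + `|z0|) => n.
  rewrite -(subrK z0 (y n)) (le_trans (ler_normD _ _))// lerD2r.
  by have := bM (M + 1) (ltr_pwDr ltr01 (lexx M)) n I; rewrite /= normr_id.
have [p Wp] := weak_compact sepH yM.
have Wuniq q : weak_cluster dot y q -> q = p.
  move=> Wq; have := cvg_cst (`|p| ^+ 2 - `|q| ^+ 2 : R).
  have cp := cF p (WF _ Wp); have cq := cF q (WF _ Wq).
  have cd : cvgn (fun n => dot (y n) (q - p) : R).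
    rewrite (_ : (fun n => _) = fun n => 2^-1 * (`|y n - p| ^+ 2 - `|y n - q| ^+ 2
        - (`|p| ^+ 2 - `|q| ^+ 2))); last first.
      apply/funext => n; rewrite !(sqr_normB Hnorm) linearBr /=; by field.
    have h (v : nat -> R) : cvgn v -> cvgn (fun n => v n ^+ 2).
      by move=> cv; exact: (is_cvgM cv cv).
    have cb : cvgn (fun n => `|y n - p| ^+ 2 - `|y n - q| ^+ 2 :> R).
      exact: (is_cvgB (h _ cp) (h _ cq)).
    exact: (is_cvgM (is_cvg_cst _) (is_cvgB cb (is_cvg_cst _))).
  move=> _; have /cvg_ex[c yc] := cd.
  have cl r : weak_cluster dot y r -> dot r (q - p) = c.
    move=> [k ki yr]; have := yr (q - p).
    have := cvg_comp _ _ (subsequence_index_cvgy ki) yc.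
    by move=> /cvg_unique h /h ->.
  apply/eqP; rewrite -subr_eq0 -normr_eq0 -sqrf_eq0 Hnorm.
  have -> : dot (q - p) (q - p) = dot q (q - p) - dot p (q - p) by rewrite linearBl.
  by rewrite (cl _ Wp) (cl _ Wq) subrr.
exists p; first exact: WF.
move=> u; apply/cvgrPdist_lt => e e0; apply: contrapT => nyp.
have [j m|k ki kP] := @subsequence_of_frequently
    (fun _ n => e <= `|dot p u - dot (y n) u|).
  apply: contrapT => nE; apply: nyp; exists m => // n /= mn.
  by rewrite ltNge; apply/negP => h; apply: nE; exists n.
have [q Wq] := @weak_compact (y \o k) M sepH (fun n => yM _).
have qp := Wuniq _ (weak_cluster_sub ki Wq).
have [j ji /(_ u)] := Wq; rewrite qp => /cvgrPdist_lt/(_ _ e0)[N _ NP].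
by have := NP _ (leqnn N); rewrite /= ltNge kP.
Qed.

(** A strong cluster point is a weak one, hence equal to p; the convergent
distances to p then have a subsequence tending to 0. *)
Lemma cvg_weak_dist_strong_cluster y p : weak_cvg dot y p ->
  cvgn (fun n => `|y n - p|) -> strong_cluster y !=set0 -> y n @[n --> \oo] --> p.
Proof.
move=> yp /cvg_ex[r yr] [q [k ki yq]].
have ypk : weak_cvg dot (y \o k) p.
  by move=> u; exact: (cvg_comp _ _ (subsequence_index_cvgy ki) (yp u)).
have qp : q = p by apply: weak_cvg_unique ypk; exact: strong_weak_cvg.
have yrk : `|y (k n) - p| @[n --> \oo] --> r.
  exact: (cvg_comp _ _ (subsequence_index_cvgy ki) yr).
have y0k : `|y (k n) - p| @[n --> \oo] --> (0 : R).
  rewrite -(normr0 H) -(subrr p); apply: cvg_norm; apply: cvgB; last exact: cvg_cst.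
  by rewrite -qp.
have r0 : r = 0 by exact: cvg_unique yrk y0k.
apply/cvgrPdist_lt => e e0; move: yr; rewrite r0 => /cvgrPdist_lt/(_ _ e0).
by apply: filterS => n; rewrite sub0r normrN normr_id distrC.
Qed.

End weak_convergence.

(** * Measurability of Hilbert-valued maps *)

Section borel_hilbert.
Context {R : realType} {H : completeNormedModType R}.
Context d {Omega : measurableType d}.

Lemma continuous_borel_measurable (f : H -> R) : continuous f ->
  measurable_fun setT (f : borelType H -> R).
Proof.
move=> cf; apply: (measurability _ (RGenOInfty.measurableE R)).
move=> _ [_ [r ->] <-]; rewrite setTI; apply: sub_sigma_algebra.
apply: open_comp; first by move=> ? _; exact: cf.
exact: interval_open.
Qed.

Lemma measurable_norm_subl (X : Omega -> H) (z : H) : random_element X ->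
  measurable_fun setT (fun w => `|X w - z|).
Proof.
move=> mX; apply: (@measurableT_comp _ _ _ _ _ _ (fun y : borelType H => `|y - z|)
  _ (X : Omega -> borelType H)) => //.
apply: continuous_borel_measurable => y.
by apply: cvg_norm; apply: cvgB; [exact: cvg_id|exact: cvg_cst].
Qed.

(** On a separable space the distance of two random elements is an infimum of
countably many random variables, so that no product Borel structure is needed. *)
Lemma measurable_norm_sub (X Y : Omega -> H) : separable H ->
  random_element X -> random_element Y ->
  measurable_fun setT (fun w => `|X w - Y w|).
Proof.
move=> sepH mX mY.
have [s [_ ds]] := separable_dense_in sepH (ex_intro setT (0 : H) I).
apply: (measurability _ (RGenInftyO.measurableE R)).
move=> _ [_ [r ->] <-]; rewrite setTI.
rewrite (_ : _ @^-1` _ = \bigcup_i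
    [set w | `|X w - s i| + `|Y w - s i| \in `]-oo, r[]).
  apply: bigcupT_measurable => i.
  rewrite -[X in measurable X]setTI.
  have := measurable_funD (measurable_norm_subl (s i) mX) (measurable_norm_subl (s i) mY).
  by move=> /(_ measurableT _ (measurable_itv `]-oo, r[)).
apply/seteqP; split => w /=; rewrite in_itv/=.
  move=> XYr; have e0 : 0 < (r - `|X w - Y w|) / 2 by rewrite divr_gt0// subr_gt0.
  have [i Xi] := ds (X w) I _ e0; exists i => //=; rewrite in_itv/=.
  have : `|Y w - s i| <= `|X w - Y w| + `|X w - s i|.
    by rewrite (distrC (X w)); exact: ler_distD.
  by move: Xi; lra.
move=> [i _ /=]; rewrite in_itv/=; apply: le_lt_trans.
by rewrite (distrC (Y w)); exact: ler_distD.
Qed.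

Lemma measurable_norm (X : Omega -> H) : random_element X ->
  measurable_fun setT (fun w => `|X w|).
Proof.
move=> mX; rewrite (_ : (fun w => _) = fun w => `|X w - 0|).
  exact: measurable_norm_subl.
by apply/funext => w; rewrite subr0.
Qed.

Lemma measurable_dot (dot : {dot H for idfun}) (X : Omega -> H) u :
  norm_from_dot dot -> random_element X ->
  measurable_fun setT (fun w => dot (X w) u : R).
Proof.
move=> Hnorm mX; apply: (@measurableT_comp _ _ _ _ _ _
  (fun y : borelType H => dot y u : R) _ (X : Omega -> borelType H)) => //.
apply: continuous_borel_measurable => y.
by apply: dot_cvg => //; exact: cvg_id.
Qed.

(** Pettis: |v|^2 is the supremum of 2 <v, s> - |s|^2 over a dense sequence of s,
so weak measurability makes the distances to points measurable, hence the
preimages of balls, and every open set is a countable union of balls. *)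
Lemma random_element_dot (dot : {dot H for idfun}) (X : Omega -> H) :
  norm_from_dot dot -> separable H ->
  (forall u, measurable_fun setT (fun w => dot (X w) u : R)) ->
  random_element X.
Proof.
move=> Hnorm sepH mX.
have [s [_ ds]] := separable_dense_in sepH (ex_intro setT (0 : H) I).
have mf z i : measurable_fun setT
    (fun w => 2 * (dot (X w) (s i) - dot z (s i)) - `|s i| ^+ 2 : R).
  apply: measurable_funB => //; apply: measurable_funM => //.
  exact: measurable_funB.
have fE v i : 2 * dot v (s i) - `|s i| ^+ 2 = `|v| ^+ 2 - `|v - s i| ^+ 2.
  by rewrite (sqr_normB Hnorm); ring.
have mball z (e : R) : 0 < e -> measurable [set w | `|X w - z| < e].
  move=> e0; rewrite (_ : [set w | _] = ~` \bigcap_j \bigcup_i [set w |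
      2 * (dot (X w) (s i) - dot z (s i)) - `|s i| ^+ 2
        \in `]e ^+ 2 - j.+1%:R^-1, +oo[]).
    apply: measurableC; apply: bigcapT_measurable => j.
    apply: bigcupT_measurable => i.
    by have := mf z i measurableT _ (measurable_itv `]e ^+ 2 - j.+1%:R^-1, +oo[);
      rewrite setTI.
  rewrite -[LHS]setCK; congr (~` _); apply/seteqP; split => w /=.
    move/negP; rewrite -leNgt => eX j _.
    have j0 : 0 < j.+1%:R^-1 :> R by rewrite invr_gt0.
    have [i Xi] := ds (X w - z) I _ j0.
    exists i => //=; rewrite in_itv/= andbT -linearBl fE.
    have j1 : j.+1%:R^-1 ^+ 2 <= j.+1%:R^-1 :> R.
      by rewrite expr2 ler_piMr ?invr_ge0// invf_le1 ?ler1n.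
    have : `|X w - z - s i| ^+ 2 < j.+1%:R^-1 ^+ 2.
      by rewrite ltr_pXn2r ?nnegrE ?invr_ge0.
    have : e ^+ 2 <= `|X w - z| ^+ 2 by rewrite lerXn2r ?nnegrE// ltW.
    by move: j1; set a := _%:R^-1; lra.
  move=> XP; apply/negP; rewrite -leNgt leNgt; apply/negP => Xe.
  have Xe2 : 0 < e ^+ 2 - `|X w - z| ^+ 2.
    by rewrite subr_gt0 ltr_pXn2r ?nnegrE ?(ltW e0).
  have [j je] : exists j, j.+1%:R^-1 < e ^+ 2 - `|X w - z| ^+ 2.
    by near \oo => j; exists j; near: j; exact: near_infty_natSinv_lt (PosNum Xe2).
  have [i _ /=] := XP j I; rewrite in_itv/= andbT -linearBl fE.
  have := sqr_ge0 `|X w - z - s i|; move: je; set a := _%:R^-1; lra.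
apply: (@measurability _ _ Omega (borelType H) setT X (@open H) erefl).
move=> _ [B oB <-]; rewrite setTI.
rewrite (_ : X @^-1` B = \bigcup_(ij : nat * nat)
    [set w | ball (s ij.1) ij.2.+1%:R^-1 `<=` B /\ `|X w - s ij.1| < ij.2.+1%:R^-1]).
  apply: countable_bigcupT_measurable => [|[i j] /=]; first exact: countableP.
  have [sO|nsO] := pselect (ball (s i) j.+1%:R^-1 `<=` B).
    rewrite (_ : [set w | _] = [set w | `|X w - s i| < j.+1%:R^-1]).
      by apply: mball; rewrite invr_gt0.
    by apply/seteqP; split => w /=; [case|].
  by rewrite (_ : [set w | _] = set0)//; apply/seteqP; split => w // -[].
apply/seteqP; split => w /=; last first.
  move=> [[i j] _ /= [sO Xi]]; apply: sO.
  by rewrite -ball_normE /ball_/= distrC.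
move=> BX; have : nbhs (X w) B by exact: open_nbhs_nbhs.
move=> /nbhs_ballP[e /= e0 eO].
have e2 : 0 < e / 2 by rewrite divr_gt0.
have [j je] : exists j, j.+1%:R^-1 < e / 2.
  by near \oo => j; exists j; near: j; exact: near_infty_natSinv_lt (PosNum e2).
have [i Xi] := ds (X w) I j.+1%:R^-1 ltac:(by rewrite invr_gt0).
exists (i, j) => //=; split => // y; rewrite -ball_normE /ball_/= => sy.
apply: eO; rewrite -ball_normE /ball_/= (le_lt_trans (ler_distD (s i) _ _))//.
by move: sy Xi je; set a := _%:R^-1; rewrite /=; lra.
Unshelve. all: by end_near. Qed.

End borel_hilbert.

(** The limit is set to a fixed point of F on a measurable null set containing the
bad event; its inner products are then everywhere limits of random
variables. *)
Lemma weak_limit_random_element (R : realType) (H : completeNormedModType R)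
    (dot : {dot H for idfun}) d (Omega : measurableType d)
    (P : probability Omega R) (F : set H) (x : nat -> Omega -> H) :
  norm_from_dot dot -> separable H -> F !=set0 ->
  (forall n, random_element (x n)) ->
  {ae P, forall w, exists2 l, F l & weak_cvg dot (fun n => x n w) l} ->
  exists xlim : Omega -> H, [/\ random_element xlim, forall w, F (xlim w) &
    {ae P, forall w, weak_cvg dot (fun n => x n w) (xlim w)}].
Proof.
move=> Hnorm Hsep [z0 Fz0] x_rv [A [mA PA0 AE]].
have /choice[xlim xlimP] : forall w, exists l, F l /\
    (if w \in A then l = z0 else weak_cvg dot (fun n => x n w) l).
  move=> w; case: (boolP (w \in A)) => wA; first by exists z0.
  have [l Fl xl] : exists2 l, F l & weak_cvg dot (fun n => x n w) l.
    by apply: contrapT => nl; move/negP: wA; apply; rewrite inE; apply: AE.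
  by exists l.
have xlimF w : F (xlim w) by have [] := xlimP w.
exists xlim; split => //; last first.
  exists A; split => // w /= nw; have [_] := xlimP w.
  by case: ifPn => [|_ /nw//]; rewrite inE.
apply: (random_element_dot Hnorm Hsep) => u.
apply: (@measurable_fun_cvg _ _ _ _ (fun n w => \1_(~` A) w * dot (x n w) u + \1_A w * dot z0 u)).
  move=> n; apply: measurable_funD; last first.
    by apply: measurable_funM => //; exact: measurable_indic.
  apply: measurable_funM; last exact: measurable_dot.
  by apply: measurable_indic; exact: measurableC.
move=> w _; have [_] := xlimP w; rewrite !indicE in_setC.
case: (w \in A) => /= [xz|xl].
  by rewrite xz mul1r; under eq_fun do rewrite mul0r add0r; exact: cvg_cst.
by rewrite mul0r; under eq_fun do rewrite mul1r addr0; exact: xl.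
Qed.

(** * One step of the iteration *)

Section relaxation.
Context {R : realType} {H : completeNormedModType R}.
Variable dot : {dot H for idfun}.
Hypothesis Hnorm : norm_from_dot dot.
Implicit Types u v x t z : H.

Lemma sqr_norm_relaxation (l : R) x t z :
  `|x + l *: (t - x) - z| ^+ 2 + l * (1 - l) * `|t - x| ^+ 2 =
  (1 - l) * `|x - z| ^+ 2 + l * `|t - z| ^+ 2.
Proof.
have -> : x + l *: (t - x) - z = (x - z) + l *: (t - x) by rewrite addrAC.
have -> : t - z = (x - z) + (t - x) by rewrite [RHS]addrC addrA subrK.
rewrite (sqr_normD Hnorm (x - z) (l *: (t - x))) (sqr_normD Hnorm (x - z) (t - x)).
rewrite linearZr_LR /= normrZ exprMn real_normK ?num_real//; ring.
Qed.

(** After expansion of the square this is Young's inequality for the cross term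
2 <u, v>. *)
Lemma sqr_normD_le (eps : R) u v : 0 < eps ->
  `|u + v| ^+ 2 <= (1 + eps) * `|u| ^+ 2 + (1 + eps^-1) * `|v| ^+ 2.
Proof.
move=> e0; rewrite (sqr_normD Hnorm).
have uv : dot u v <= `|u| * `|v| by apply: le_trans (dot_le_norm Hnorm u v); exact: ler_norm.
have : 0 <= eps^-1 * (eps * `|u| - `|v|) ^+ 2.
  by rewrite mulr_ge0 ?sqr_ge0// invr_ge0 ltW.
have -> : eps^-1 * (eps * `|u| - `|v|) ^+ 2 =
    eps * `|u| ^+ 2 - 2 * (`|u| * `|v|) + eps^-1 * `|v| ^+ 2.
  by field; rewrite gt_eqF.
lra.
Qed.

End relaxation.

Section one_step.
Context {R : realType} {H : completeNormedModType R}.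
Variable dot : {dot H for idfun}.
Hypotheses (Hnorm : norm_from_dot dot) (Hsep : separable H).
Context d {Omega : measurableType d}.
Variables (P : probability Omega R) (G : set (set Omega)).
Hypotheses (sG : sigma_algebra setT G) (GM : G `<=` @measurable _ Omega).
Local Notation OG := (g_sigma_algebraType G).
Local Notation measG f := (measurable_fun [set: OG] (f : OG -> _)).

Let toO (f : Omega -> R) : measG f -> measurable_fun [set: Omega] f.
Proof. exact: (measurable_fun_sub_sigma sG GM). Qed.

Lemma integral_weight_cond_exp (X : Omega -> R) (phi : Omega -> R) :
  measurable_fun setT X -> (forall w, 0 <= X w) ->
  measG phi -> (forall w, 0 <= phi w) ->
  (\int[P]_w ((phi w)%:E * cond_exp P G (EFin \o X) w) =
   \int[P]_w (phi w * X w)%:E)%E.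
Proof.
move=> mX X0 mphi phi0; have [c0 mc cE] := cond_expP P sG GM mX X0.
have mc' : measurable_fun setT (cond_exp P G (EFin \o X)).
  by apply: (measurable_fun_sub_sigma sG GM); exact/(measurable_wrtP sG).
have -> := @integral_weight_eq _ _ _ P G sG GM (EFin \o X) _
  (EFin \o phi) _ _ mc' c0 cE => //.
- exact/measurable_EFinP.
- exact/measurable_EFinP.
Qed.

Variables (l : R) (x x' t e : Omega -> H) (z : H) (eps mu nu theta : Omega -> R).
Hypotheses (l_gt0 : 0 < l) (l_le1 : l <= 1).
Hypotheses (mx : random_element x) (mx' : random_element x')
  (mt : random_element t) (me : random_element e).
Hypothesis mxz : measG (fun w => `|x w - z|).
Hypotheses (meps : measG eps) (mmu : measG mu) (mnu : measG nu)
  (mtheta : measG theta).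
Hypotheses (eps0 : forall w, 0 < eps w) (mu0 : forall w, 0 <= mu w)
  (nu0 : forall w, 0 <= nu w) (theta0 : forall w, 0 <= theta w).
Hypothesis x'E : {ae P, forall w, x' w = x w + l *: (t w + e w - x w)}.
Hypothesis eE : {ae P, forall w,
  ((l ^+ 2)%:E * cond_exp P G (fun w' => (`|e w'| ^+ 2)%:E) w
   <= (eps w ^+ 2)%:E)%E}.
Hypothesis tE : {ae P, forall w,
  (cond_exp P G (fun w' => (`|t w' - z| ^+ 2)%:E) w + (theta w)%:E
   <= ((1 + mu w) * `|x w - z| ^+ 2 + nu w)%:E)%E}.

Let mu' w := (1 + eps w) * (1 + l * mu w) - 1.
Let nu' w := (1 + eps w) * (l * nu w) + eps w + eps w ^+ 2.
Let theta' w := ((l * theta w)%:E + (l * (1 - l))%:E *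
  cond_exp P G (fun w' => (`|t w' - x w'| ^+ 2)%:E) w)%E.

(** The three squared norms of the relaxed step and the error are integrated
against G-measurable weights, then |t - z|^2 and |e|^2 are replaced by their
conditional expectations, for which bounds are available. *)
Lemma one_step_decrease (phi : Omega -> R) :
  measG phi -> (forall w, 0 <= phi w) ->
  (\int[P]_w (phi w * `|x' w - z| ^+ 2)%:E + \int[P]_w ((phi w)%:E * theta' w)
   <= \int[P]_w (phi w * ((1 + mu' w) * `|x w - z| ^+ 2 + nu' w))%:E)%E.
Proof.
move=> mphi phi0.
pose X w := `|x w - z| ^+ 2; pose X' w := `|x' w - z| ^+ 2.
pose T w := `|t w - z| ^+ 2; pose D w := `|t w - x w| ^+ 2.
pose E w := `|e w| ^+ 2.
have mXG : measG X by exact: measurable_funX.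
have mX : measurable_fun setT X by exact: toO.
have mX' : measurable_fun setT X'.
  by apply: measurable_funX; exact: measurable_norm_subl.
have mT : measurable_fun setT T.
  by apply: measurable_funX; exact: measurable_norm_subl.
have mD : measurable_fun setT D.
  by apply: measurable_funX; exact: measurable_norm_sub.
have mE : measurable_fun setT E.
  by apply: measurable_funX; exact: measurable_norm.
have [X0 X'0] : (forall w, 0 <= X w) /\ (forall w, 0 <= X' w) by split => w; exact: sqr_ge0.
have [T0 [D0 E0]] : (forall w, 0 <= T w) /\ (forall w, 0 <= D w) /\ (forall w, 0 <= E w).
  by do !split => *; exact: sqr_ge0.
pose CT := cond_exp P G (EFin \o T); pose CD := cond_exp P G (EFin \o D).
pose CE := cond_exp P G (EFin \o E).
have [CT0 mCT _] := cond_expP P sG GM mT T0.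
have [CD0 mCD _] := cond_expP P sG GM mD D0.
have [CE0 mCE _] := cond_expP P sG GM mE E0.
have mC C : measurable_wrt G C -> measurable_fun [set: Omega] (C : Omega -> \bar R).
  by move=> /(measurable_wrtP sG); exact: measurable_fun_sub_sigma.
have l1 : 0 <= l * (1 - l) by rewrite mulr_ge0 ?subr_ge0// ltW.
have l0 : 0 <= l by exact: ltW.
have e0 w : 0 <= eps w by exact: ltW.
(* The coefficients with which |t - x|^2, |x - z|^2, |t - z|^2 and |e|^2 enter the
   inequality; each is a weight measurable for G, so it commutes with the
   conditional expectation. *)
pose pD w := phi w * (l * (1 - l)).
pose pX w := phi w * ((1 + eps w) * (1 - l)).
pose pT w := phi w * ((1 + eps w) * l).
pose pE w := phi w * ((1 + (eps w)^-1) * l ^+ 2).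
have mepsV : measG (fun w => (eps w)^-1) by exact: measurable_inv_gt0.
have m1eps : measG (fun w => 1 + eps w) by exact: measurable_funD.
have mpD : measG pD by exact: measurable_funM.
have mpX : measG pX by apply: measurable_funM => //; exact: measurable_funM.
have mpT : measG pT by apply: measurable_funM => //; exact: measurable_funM.
have mpE : measG pE.
  by apply: measurable_funM => //; apply: measurable_funM => //; exact: measurable_funD.
have pD0 w : 0 <= pD w by rewrite mulr_ge0.
have l2 : 0 <= 1 - l by rewrite subr_ge0.
have e1 w : 0 <= 1 + eps w by rewrite addr_ge0.
have e2 w : 0 <= 1 + (eps w)^-1 by rewrite addr_ge0// invr_ge0.
have pX0 w : 0 <= pX w by rewrite /pX !mulr_ge0.
have pT0 w : 0 <= pT w by rewrite /pT !mulr_ge0.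
have pE0 w : 0 <= pE w by rewrite /pE !mulr_ge0// sqr_ge0.
have mER (f : Omega -> R) : measurable_fun setT f ->
    measurable_fun setT (fun w => (f w)%:E) by move=> mf; exact/measurable_EFinP.
have mpC (p : Omega -> R) C : measG p -> measurable_wrt G C ->
    measurable_fun setT (fun w => ((p w)%:E * C w)%E).
  by move=> mp /mC mCC; apply: emeasurable_funM => //; apply: mER; exact: toO.
have mpR (p f : Omega -> R) : measG p -> measurable_fun setT f ->
    measurable_fun setT (fun w => (p w * f w)%:E).
  by move=> mp mf; apply: mER; apply: measurable_funM => //; exact: toO.
have pC0 (p : Omega -> R) C : (forall w, 0 <= p w) -> (forall w, 0 <= C w)%E ->
    forall w, (0 <= (p w)%:E * C w)%E.
  by move=> p0 C0 w; rewrite mule_ge0// lee_fin.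
have pR0 (p f : Omega -> R) : (forall w, 0 <= p w) -> (forall w, 0 <= f w) ->
    forall w, (0 <= (p w * f w)%:E)%E.
  by move=> p0 f0 w; rewrite lee_fin mulr_ge0.
have mpth : measG (fun w => phi w * (l * theta w)).
  by apply: measurable_funM => //; exact: measurable_funM.
have thE : (\int[P]_w ((phi w)%:E * theta' w) =
    \int[P]_w (phi w * (l * theta w))%:E + \int[P]_w (pD w * D w)%:E)%E.
  rewrite -(integral_weight_cond_exp mD D0 mpD pD0) -ge0_integralD//.
  - apply: eq_integral => w _.
    rewrite /theta' ge0_muleDr ?lee_fin ?mulr_ge0//; last first.
      by rewrite mule_ge0// lee_fin.
    by rewrite muleA -!EFinM.
  - by move=> w _; rewrite lee_fin !mulr_ge0.
  - by apply: mER; exact: toO.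
  - by move=> w _; exact: pC0.
  - exact: mpC.
rewrite thE addeCA.
have step1 : (\int[P]_w (phi w * X' w)%:E + \int[P]_w (pD w * D w)%:E <=
    \int[P]_w (pX w * X w)%:E + (\int[P]_w (pT w * T w)%:E +
      \int[P]_w (pE w * E w)%:E))%E.
  rewrite -ge0_integralD//; [|by move=> w _; exact: pR0|exact: mpR
    |by move=> w _; exact: pR0|exact: mpR].
  rewrite -[in leRHS]ge0_integralD//; [|by move=> w _; exact: pR0|exact: mpR
    |by move=> w _; exact: pR0|exact: mpR].
  rewrite -ge0_integralD//; [|by move=> w _; exact: pR0|exact: mpR
    |by move=> w _; apply: adde_ge0; exact: pR0
    |by apply: emeasurable_funD; exact: mpR].
  apply: ae_ge0_le_integral => //.
  - by move=> w _; apply: adde_ge0; exact: pR0.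
  - by apply: emeasurable_funD; exact: mpR.
  - by move=> w _; do 2 (apply: adde_ge0; [exact: pR0|]); exact: pR0.
  - by do 2 (apply: emeasurable_funD; [exact: mpR|]); exact: mpR.
  apply: filterS x'E => w xE _; rewrite -!EFinD lee_fin /pD /pX /pT /pE -!mulrA -!mulrDr.
  rewrite ler_wpM2l//.
  have -> : X' w = `|(x w + l *: (t w - x w) - z) + l *: e w| ^+ 2.
    rewrite /X' xE; congr (`|_| ^+ 2).
    by rewrite [t w + e w - _]addrAC scalerDr (addrA (x w)); exact: addrAC.
  have := sqr_norm_relaxation Hnorm l (x w) (t w) z.
  have := sqr_normD_le Hnorm (x w + l *: (t w - x w) - z) (l *: e w) (eps0 w).
  rewrite normrZ exprMn real_normK ?num_real// -/(X w) -/(T w) -/(D w) -/(E w).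
  have : 0 <= eps w * (l * (1 - l) * D w) by rewrite !mulr_ge0.
  set s := `|_ + _| ^+ 2; set q := `|_ - z| ^+ 2; set r := (eps w)^-1.
  move=> h1 + h3; have -> : q = (1 - l) * X w + l * T w - l * (1 - l) * D w.
    by rewrite -h3 addrK.
  by move: h1; lra.
apply: (le_trans (leeD2l _ step1)).
rewrite -(integral_weight_cond_exp mT T0 mpT pT0).
rewrite -(integral_weight_cond_exp mE E0 mpE pE0) -/CT -/CE.
rewrite -[in leLHS]ge0_integralD//; [|by move=> w _; exact: pC0|exact: mpC
  |by move=> w _; exact: pC0|exact: mpC].
rewrite -[in leLHS]ge0_integralD//; [|by move=> w _; exact: pR0|exact: mpR
  |by move=> w _; apply: adde_ge0; exact: pC0
  |by apply: emeasurable_funD; exact: mpC].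
rewrite -ge0_integralD//; [|by move=> w _; rewrite lee_fin !mulr_ge0
  |by apply: mER; exact: toO
  |by move=> w _; apply: adde_ge0; [exact: pR0|apply: adde_ge0; exact: pC0]
  |by apply: emeasurable_funD; [exact: mpR|apply: emeasurable_funD; exact: mpC]].
have mu'0 w : 0 <= 1 + mu' w.
  by rewrite /mu' addrC subrK mulr_ge0 ?addr_ge0// mulr_ge0.
have nu'0 w : 0 <= nu' w.
  by rewrite /nu' !addr_ge0 ?sqr_ge0// mulr_ge0 ?addr_ge0// mulr_ge0.
apply: ae_ge0_le_integral => //.
- move=> w _; do 2 (apply: adde_ge0; first by rewrite lee_fin !mulr_ge0 ?pX0).
  by apply: adde_ge0; exact: pC0.
- apply: emeasurable_funD; first by apply: mER; exact: toO.
  by apply: emeasurable_funD; [exact: mpR|apply: emeasurable_funD; exact: mpC].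
- by move=> w _; rewrite lee_fin mulr_ge0// addr_ge0// mulr_ge0.
- apply: mER; apply: toO; apply: measurable_funM => //; apply: measurable_funD.
    apply: measurable_funM => //; apply: measurable_funD => //.
    apply: measurable_funB => //; apply: measurable_funM => //.
    by apply: measurable_funD => //; exact: measurable_funM.
  apply: measurable_funD; last exact: measurable_funX.
  apply: measurable_funD => //; apply: measurable_funM => //.
  exact: measurable_funM.
apply: filterS2 tE eE => w.
rewrite -/CT -/CE -/(X w) => tw ew _.
have CTfin : CT w \is a fin_num.
  rewrite ge0_fin_numE//; apply: le_lt_trans (ltry ((1 + mu w) * X w + nu w)).
  by apply: le_trans tw; rewrite leeDl// lee_fin.
have CEfin : CE w \is a fin_num.
  rewrite ge0_fin_numE// ltey; apply: contraTN ew => /eqP ->.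
  by rewrite gt0_muley ?lte_fin ?exprn_gt0// leye_eq.
move: tw ew; rewrite -(fineK CTfin) -(fineK CEfin).
set a := fine (CT w); set b := fine (CE w).
rewrite -!EFinM -!EFinD !lee_fin => ta eb.
rewrite /pX /pT /pE -!mulrA -!mulrDr ler_wpM2l// /mu' /nu'.
have h1 : (1 + eps w) * l * (a + theta w) <=
    (1 + eps w) * l * ((1 + mu w) * X w + nu w) by rewrite ler_wpM2l// mulr_ge0.
have h2 : (1 + (eps w)^-1) * (l ^+ 2 * b) <= eps w ^+ 2 + eps w.
  apply: (le_trans (ler_wpM2l (e2 w) eb)).
  rewrite le_eqVlt; apply/orP; left; apply/eqP; field.
  by rewrite gt_eqF.
have h3 : 0 <= eps w * (l * theta w) by rewrite !mulr_ge0.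
move: h1 h2 h3; lra.
Qed.

End one_step.

(** * Convergence of the stochastic iteration *)

Section stochastic_iteration.
Context {R : realType} {H : completeNormedModType R}.
Variable dot : {dot H for idfun}.
Hypotheses (Hnorm : norm_from_dot dot) (Hsep : separable H).
Context d {Omega : measurableType d}.
Variable P : probability Omega R.
Variables (lambda : nat -> R) (lambda01 : forall n, 0 < lambda n <= 1).
Variables (t x e : nat -> Omega -> H).
Hypotheses (t_rv : forall n, random_element (t n))
  (x_rv : forall n, random_element (x n))
  (e_rv : forall n, random_element (e n)).
Hypothesis hi : forall n, {ae P, forall w,
  x n.+1 w = x n w + lambda n *: (t n w + e n w - x n w)}.
Let G := natural_filtration x.
Hypothesis hii : {ae P, forall w,
  (\sum_(0 <= n <oo) (lambda n)%:E *
     sqrte (cond_exp P (G n) (fun w' => (`|e n w'| ^+ 2)%:E) w) < +oo)%E}.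

Lemma filtration_natural_filtration : filtration G.
Proof.
split=> n.
- exact: sigma_algebra_natural_filtration.
- exact: natural_filtration_measurable.
- apply: smallest_sub; first exact: smallest_sigma_algebra.
  move=> A [i /= ni Ai]; apply: sub_sigma_algebra.
  by exists i => //=; exact: leqW.
Qed.

Let fG := filtration_natural_filtration.
Let sG n : sigma_algebra setT (G n). Proof. by case: fG. Qed.
Let GM n : G n `<=` @measurable _ Omega. Proof. by case: fG. Qed.
Local Notation measG n f := (measurable_fun [set: g_sigma_algebraType (G n)]
  (f : g_sigma_algebraType (G n) -> _)).

Lemma measurable_dist_natural n z : measG n (fun w => `|x n w - z|).
Proof.
apply: measurable_norm_subl; apply/(@measurable_wrtP _ _ _ (sG n)) => B mB.
apply: sub_sigma_algebra; exists n => //=.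
by exists B => //; rewrite setTI.
Qed.

Let E n := cond_exp P (G n) (fun w' => (`|e n w'| ^+ 2)%:E).
Let a n w : R := lambda n * Num.sqrt (fine (E n w)).
(* The geometric term keeps eps positive, as Young's inequality divides by it. *)
Let eps n w : R := a n w + 2 ^- n.+1.

Let lambda_gt0 n : 0 < lambda n. Proof. by case/andP: (lambda01 n). Qed.
Let lambda_le1 n : lambda n <= 1. Proof. by case/andP: (lambda01 n). Qed.
Let lambda_ge0 n : 0 <= lambda n. Proof. exact: ltW. Qed.

Let EP n : is_cond_exp P (G n) (fun w' => (`|e n w'| ^+ 2)%:E) (E n).
Proof.
apply: (cond_expP P (sG n) (@GM n) (X := fun w => `|e n w| ^+ 2)).
  by apply: measurable_funX; exact: measurable_norm.
by move=> w; exact: sqr_ge0.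
Qed.

Let E_ge0 n w : (0 <= E n w)%E. Proof. by have [] := EP n. Qed.

Let a_ge0 n w : 0 <= a n w. Proof. by rewrite mulr_ge0// sqrtr_ge0. Qed.

Let eps_gt0 n w : 0 < eps n w.
Proof. by rewrite ltr_wpDl// invr_gt0 exprn_gt0. Qed.

Let measG_eps n : measG n (eps n).
Proof.
have [_ mE _] := EP n; apply: measurable_funD => //.
apply: measurable_funM => //.
have msqrt : measurable_fun setT (@Num.sqrt R).
  by apply: continuous_measurable_fun; exact: sqrt_continuous.
apply: (@measurableT_comp _ _ _ _ _ _ (@Num.sqrt R) _
  (fine \o E n : g_sigma_algebraType (G n) -> R)) => //.
apply: measurableT_comp => //.
exact/(measurable_wrtP (sG n)).
Qed.

Let E_lty : {ae P, forall w, forall n, (E n w < +oo)%E}.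
Proof.
apply: filterS hii => w sE n; rewrite ltey; apply/negP => /eqP Ey.
have t0 k : (0 <= (lambda k)%:E * sqrte (E k w))%E.
  by rewrite mule_ge0// ?lee_fin// sqrte_ge0.
move: sE; rewrite (eseries_pinfty _ _ (k := n))//.
- by move=> k _; rewrite -ltNye (lt_le_trans _ (t0 k))// ltNy0.
- by rewrite -/(E n) Ey gt0_muley ?lte_fin.
Qed.

Let sum_eps : {ae P, forall w, (\sum_(0 <= n <oo) (eps n w)%:E < +oo)%E}.
Proof.
apply: filterS2 hii E_lty => w sE Ey; apply: nneseries_ltyD => //.
  move: sE; congr (_ < _)%E; apply: eq_eseriesr => n _.
  have En : E n w \is a fin_num by rewrite ge0_fin_numE.
  by rewrite /a EFinM -/(E n) -{1}(fineK En).
exact: nneseries_lty_geometric.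
Qed.

Let eps_error n : {ae P, forall w,
  ((lambda n ^+ 2)%:E * E n w <= (eps n w ^+ 2)%:E)%E}.
Proof.
apply: filterS E_lty => w /(_ n) Ey.
have En : E n w \is a fin_num by rewrite ge0_fin_numE.
have E0 : 0 <= fine (E n w) by exact: fine_ge0.
rewrite -(fineK En) -EFinM lee_fin -{1}(sqr_sqrtr E0) -exprMn -/(a n w).
by rewrite lerXn2r ?nnegrE ?(ltW (eps_gt0 n w))// lerDl invr_ge0 exprn_ge0.
Qed.

Let D n := cond_exp P (G n) (fun w' => (`|t n w' - x n w'| ^+ 2)%:E).

Let DP n : is_cond_exp P (G n) (fun w' => (`|t n w' - x n w'| ^+ 2)%:E) (D n).
Proof.
apply: (cond_expP P (sG n) (@GM n) (X := fun w => `|t n w - x n w| ^+ 2)).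
  by apply: measurable_funX; exact: measurable_norm_sub.
by move=> w; exact: sqr_ge0.
Qed.

(** For one target point, the squared distances form an almost-supermartingale
whose multiplicative and additive perturbations are summable. *)
Lemma quasi_fejer (z : H) (theta mu nu : nat -> Omega -> R) :
  ell_plus G theta -> ell_plus G mu -> ell_plus G nu ->
  ell_plus_p P G 1 (fun n w => lambda n * mu n w) ->
  ell_plus_p P G 2^-1 (fun n w => lambda n * nu n w) ->
  {ae P, forall w, forall n,
    (cond_exp P (G n) (fun w' => (`|t n w' - z| ^+ 2)%:E) w + (theta n w)%:E
     <= ((1 + mu n w) * `|x n w - z| ^+ 2 + nu n w)%:E)%E} ->
  {ae P, forall w, cvgn (fun n => `|x n w - z|) /\
    (\sum_(0 <= n <oo) ((lambda n * theta n w)%:E +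
       (lambda n * (1 - lambda n))%:E * D n w) < +oo)%E}.
Proof.
move=> Ltheta Lmu Lnu [_ sum_mu] [_ sum_nu] tz.
have theta0 n w : 0 <= theta n w by have [] := Ltheta n.
have mu0 n w : 0 <= mu n w by have [] := Lmu n.
have nu0 n w : 0 <= nu n w by have [] := Lnu n.
have mtheta n : measG n (theta n) by have [_ /(measurable_wrtP (sG n))] := Ltheta n.
have mmu n : measG n (mu n) by have [_ /(measurable_wrtP (sG n))] := Lmu n.
have mnu n : measG n (nu n) by have [_ /(measurable_wrtP (sG n))] := Lnu n.
have mxz n := @measurable_dist_natural n z.
have eps0 n w : 0 <= eps n w by exact: ltW.
have D0 n w : (0 <= D n w)%E by have [] := DP n.
have lm0 n w : 0 <= lambda n * mu n w by rewrite mulr_ge0.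
have ln0 n w : 0 <= lambda n * nu n w by rewrite mulr_ge0.
pose mu' n w := (1 + eps n w) * (1 + lambda n * mu n w) - 1.
pose nu' n w := (1 + eps n w) * (lambda n * nu n w) + eps n w + eps n w ^+ 2.
pose theta' n w := ((lambda n * theta n w)%:E +
  (lambda n * (1 - lambda n))%:E * D n w)%E.
have mu'E n w : mu' n w = eps n w + (1 + eps n w) * (lambda n * mu n w).
  by rewrite /mu'; ring.
have ll0 n : 0 <= lambda n * (1 - lambda n) by rewrite mulr_ge0 ?subr_ge0.
have : {ae P, forall w, cvgn (fun n => `|x n w - z| ^+ 2) /\
    (\sum_(0 <= n <oo) theta' n w < +oo)%E}; last first.
  apply: filterS => w [cx st]; split => //.
  have -> : (fun n => `|x n w - z|) = Num.sqrt \o (fun n => `|x n w - z| ^+ 2).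
    by apply/funext => n /=; rewrite sqrtr_sqr normr_id.
  have /cvg_ex[l xl] := cx; apply/cvg_ex; exists (Num.sqrt l).
  apply: cvg_comp xl _; exact: sqrt_continuous.
apply: (@robbins_siegmund _ _ _ P G (fun n w => `|x n w - z| ^+ 2) mu' nu' theta' fG)
  => [n|n|n|n|n w|n w|n w|n w|n phi mphi phi0| |].
- exact: measurable_funX.
- apply: measurable_funB => //; apply: measurable_funM.
    by apply: measurable_funD => //; exact: measG_eps.
  by apply: measurable_funD => //; exact: measurable_funM.
- apply: measurable_funD; last by apply: measurable_funX; exact: measG_eps.
  apply: measurable_funD; last exact: measG_eps.
  apply: measurable_funM; last exact: measurable_funM.
  by apply: measurable_funD => //; exact: measG_eps.
- apply: emeasurable_funD.
    apply/measurable_EFinP; apply: measurable_funM => //.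
    exact: (measurable_fun_sub_sigma (sG n) (@GM n)).
  apply: emeasurable_funM => //.
  have [_ /(measurable_wrtP (sG n)) mD _] := DP n.
  exact: (measurable_fun_sub_sigma (sG n) (@GM n)).
- exact: sqr_ge0.
- by rewrite mu'E addr_ge0// mulr_ge0// addr_ge0.
- by rewrite /nu' !addr_ge0 ?sqr_ge0// mulr_ge0// addr_ge0.
- by rewrite adde_ge0 ?mule_ge0 ?lee_fin// mulr_ge0.
- apply: (@one_step_decrease _ _ _ Hnorm Hsep _ _ P (G n) (sG n) (@GM n)
    (lambda n) (x n) (x n.+1) (t n) (e n) z (eps n) (mu n) (nu n) (theta n)) => //.
  by apply: filterS tz.
- apply: filterS2 sum_eps sum_mu => w se sm.
  under eq_eseriesr do rewrite mu'E.
  have [C C0 eC] := nneseries_lty_bounded (fun n => eps0 n w) se.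
  apply: nneseries_ltyD => // [n|]; first by rewrite mulr_ge0// addr_ge0.
  apply: (@nneseries_ltyM _ _ _ (1 + C)) => // [n|].
    by rewrite addr_ge0//= lerD2l.
  move: sm; congr (_ < _)%E; apply: eq_eseriesr => n _.
  by rewrite powRr1.
- apply: filterS2 sum_eps sum_nu => w se /nneseries_lty_sqrt sn.
  have [C C0 eC] := nneseries_lty_bounded (fun n => eps0 n w) se.
  apply: nneseries_ltyD => // [n|n| |].
  + by rewrite addr_ge0// mulr_ge0// addr_ge0.
  + exact: sqr_ge0.
  + apply: nneseries_ltyD => // [n|]; first by rewrite mulr_ge0// addr_ge0.
    apply: (@nneseries_ltyM _ _ _ (1 + C)) => // [n|]; last exact: sn.
    by rewrite addr_ge0//= lerD2l.
  + apply: (@nneseries_ltyM _ _ _ C) => // n.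
    by rewrite eps0 eC.
Qed.

End stochastic_iteration.

Theorem theorem2p5 (R : realType)
  (H : completeNormedModType R) (dot : {dot H for idfun})
  (Hnorm : norm_from_dot dot) (Hsep : separable H)
  (d : measure_display) (Omega : measurableType d) (P : probability Omega R)
  (F : set H) (F_neq0 : F !=set0) (F_closed : closed F)
  (lambda : nat -> R) (lambda01 : forall n, 0 < lambda n <= 1)
  (t x e : nat -> Omega -> H)
  (t_rv : forall n, random_element (t n))
  (x_rv : forall n, random_element (x n))
  (e_rv : forall n, random_element (e n))
  (hi : forall n, {ae P, forall w,
     x n.+1 w = x n w + lambda n *: (t n w + e n w - x n w)})
  (hii : {ae P, forall w,
     (\sum_(0 <= n <oo) (lambda n)%:E *
        sqrte (cond_exp P (natural_filtration x n)
                 (fun w' => (`|e n w'| ^+ 2)%:E) w) < +oo)%E})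
  (theta mu nu : H -> nat -> Omega -> R)
  (hiii : forall z, F z ->
     ell_plus (natural_filtration x) (theta z) /\
     ell_plus_oo P (natural_filtration x) (mu z) /\
     ell_plus_oo P (natural_filtration x) (nu z) /\
     ell_plus_p P (natural_filtration x) 1
       (fun n w => lambda n * mu z n w) /\
     ell_plus_p P (natural_filtration x) 2^-1
       (fun n w => lambda n * nu z n w) /\
     {ae P, forall w, forall n,
       (cond_exp P (natural_filtration x n)
          (fun w' => (`|t n w' - z| ^+ 2)%:E) w + (theta z n w)%:E
        <= ((1 + mu z n w) * `|x n w - z| ^+ 2 + nu z n w)%:E)%E}) :
  (forall z, F z ->
     {ae P, forall w,
       (\sum_(0 <= n <oo) (lambda n * theta z n w)%:E < +oo)%E}) /\
  {ae P, forall w,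
     (\sum_(0 <= n <oo) (lambda n * (1 - lambda n))%:E *
        cond_exp P (natural_filtration x n)
          (fun w' => (`|t n w' - x n w'| ^+ 2)%:E) w < +oo)%E} /\
  ({ae P, forall w, weak_cluster dot (fun n => x n w) `<=` F} ->
   exists xlim : Omega -> H,
     [/\ random_element xlim,
         forall w, F (xlim w),
         {ae P, forall w, weak_cvg dot (fun n => x n w) (xlim w)} &
         {ae P, forall w, strong_cluster (fun n => x n w) !=set0} ->
         {ae P, forall w, x n w @[n --> \oo] --> xlim w}]).
Proof.
have fejer z : F z -> {ae P, forall w, cvgn (fun n => `|x n w - z|) /\
    (\sum_(0 <= n <oo) ((lambda n * theta z n w)%:E +
       (lambda n * (1 - lambda n))%:E * cond_exp P (natural_filtration x n)
          (fun w' => (`|t n w' - x n w'| ^+ 2)%:E) w) < +oo)%E}.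
  move=> /hiii[Ltheta [[Lmu _] [[Lnu _] [sum_mu [sum_nu tz]]]]].
  exact: (quasi_fejer Hnorm Hsep lambda01 t_rv x_rv e_rv hi hii
    Ltheta Lmu Lnu sum_mu sum_nu tz).
have l0 n : 0 <= lambda n by case/andP: (lambda01 n) => /ltW.
have l1 n : 0 <= lambda n * (1 - lambda n).
  by rewrite mulr_ge0// subr_ge0; case/andP: (lambda01 n).
have CE0 n w : (0 <= cond_exp P (natural_filtration x n)
    (fun w' => (`|t n w' - x n w'| ^+ 2)%:E) w)%E.
  have mD : measurable_fun setT (fun w' => `|t n w' - x n w'| ^+ 2).
    by apply: measurable_funX; exact: measurable_norm_sub.
  by have [] := cond_expP P (sigma_algebra_natural_filtration x n)
    (@natural_filtration_measurable _ _ _ x n x_rv) mD (fun=> sqr_ge0 _).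
have th0 z n w : F z -> 0 <= theta z n w by move=> /hiii[/(_ n)[]].
split; [|split].
- move=> z Fz; apply: filterS (fejer z Fz) => w [_].
  apply: le_lt_trans; apply: lee_nneseries => n _.
    by rewrite lee_fin mulr_ge0// th0.
  by rewrite leeDl// mule_ge0// lee_fin.
- have [z Fz] := F_neq0; apply: filterS (fejer z Fz) => w [_].
  apply: le_lt_trans; apply: lee_nneseries => n _.
    by rewrite mule_ge0// lee_fin.
  by rewrite leeDr// lee_fin mulr_ge0// th0.
move=> WF.
have [D [DF Ddense]] := separable_dense_in Hsep F_neq0.
have dist_cvg : {ae P, forall w, forall z, F z -> cvgn (fun n => `|x n w - z|)}.
  have : {ae P, forall w, forall i, cvgn (fun n => `|x n w - D i|)}.
    by apply: ae_foralln => i; apply: filterS (fejer _ (DF i)) => w [].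
  by apply: filterS => w cD; exact: (is_cvg_dist_dense_in (conj DF Ddense) cD).
have weak : {ae P, forall w, exists2 l, F l & weak_cvg dot (fun n => x n w) l}.
  by apply: filterS2 dist_cvg WF => w cF WFw; exact: (opial Hnorm Hsep F_neq0 cF WFw).
have [xlim [rv xlimF xlimW]] := weak_limit_random_element Hnorm Hsep F_neq0 x_rv weak.
exists xlim; split => // SC.
apply: filterS3 dist_cvg xlimW SC => w cF xw sc.
exact: (cvg_weak_dist_strong_cluster Hnorm xw (cF _ (xlimF w)) sc).
Qed.
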